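(* Let $\{X, X_{n}; n \geq 1\}$ be a sequence of i.i.d. non-degenerate real-valued random variables with $\mathbb{E}X^{2} < \infty$, and let $S_n=\sum_{i=1}^n X_i$. Write $\mu = \mathbb{E}X$ and $\sigma^{2} = \mathbb{E}(X - \mu)^{2} \in (0, \infty)$. Let $\rho\ge 0$ and $g \in \mathcal{V}_{\rho}$. Then for all $x>0$: \[ \limsup_{n \rightarrow \infty} \frac{\log \mathbb{P}\left(S_{n} - n \mu > x \sqrt{n g(\log n)} \right)}{g(\log n)} = - \left(\frac{x^{2}}{2\sigma^{2}} \wedge \frac{\overline{\lambda}_{1}}{2^{\rho}} \right),\quad \liminf_{n \rightarrow \infty} \frac{\log \mathbb{P}\left(S_{n} - n \mu > x \sqrt{n g(\log n)} \right)}{g(\log n)} = - \left(\frac{x^{2}}{2\sigma^{2}} \wedge \frac{\underline{\lambda}_{1}}{2^{\rho}} \right), \] \[ \limsup_{n \rightarrow \infty} \frac{\log \mathbb{P}\left(S_{n} - n \mu < -x \sqrt{n g(\log n)} \right)}{g(\log n)} = - \left(\frac{x^{2}}{2\sigma^{2}} \wedge \frac{\overline{\lambda}_{2}}{2^{\rho}} \right),\quad \liminf_{n \rightarrow \infty} \frac{\log \mathbb{P}\left(S_{n} - n \mu < - x \sqrt{n g(\log n)} \right)}{g(\log n)} = - \left(\frac{x^{2}}{2\sigma^{2}} \wedge \frac{\underline{\lambda}_{2}}{2^{\rho}} \right), \] \[ \limsup_{n \rightarrow \infty} \frac{\log \mathbb{P}\left(\left|S_{n} - n \mu \right| > x \sqrt{n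 g(\log n)} \right)}{g(\log n)} = - \left(\frac{x^{2}}{2\sigma^{2}} \wedge \frac{\overline{\lambda}}{2^{\rho}} \right),\quad \liminf_{n \rightarrow \infty} \frac{\log \mathbb{P}\left(\left|S_{n} - n \mu \right| > x \sqrt{n g(\log n)} \right)}{g(\log n)} = - \left(\frac{x^{2}}{2\sigma^{2}} \wedge \frac{\underline{\lambda}}{2^{\rho}} \right). \] Hence: $\lim_{n\to\infty} \frac{\log \mathbb{P}(S_{n}- n \mu > x \sqrt{n g(\log n)})}{g(\log n)} = - \left(\frac{x^{2}}{2\sigma^{2}} \wedge \frac{\hat{\lambda}_{1}}{2^{\rho}} \right)$ for all $x > 0$ if and only if $\overline{\lambda}_{1} = \underline{\lambda}_{1} = \hat{\lambda}_{1}$; $\lim_{n\to\infty} \frac{\log \mathbb{P}(S_{n} - n \mu < - x \sqrt{n g(\log n)})}{g(\log n)} = - \left(\frac{x^{2}}{2\sigma^{2}} \wedge \frac{\hat{\lambda}_{2}}{2^{\rho}} \right)$ for all $x > 0$ if and only if $\overline{\lambda}_{2} = \underline{\lambda}_{2} = \hat{\lambda}_{2}$; and $\lim_{n\to\infty} \frac{\log \mathbb{P}(|S_{n} - n \mu| > x \sqrt{n g(\log n)})}{g(\log n)} = - \left(\frac{x^{2}}{2\sigma^{2}} \wedge \frac{\hat{\lambda}}{2^{\rho}} \right)$ for all $x > 0$ if and only if $\overline{\lambda} = \underline{\lambda} = \hat{\lambda}$ (here $\hat\lambda_1,\hat\lambda_2,\hat\lambda\in[0,\infty]$). In particular, $\lim_{n\to\infty}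 \frac{\log \mathbb{P}(S_{n} - n \mu > x \sqrt{n g(\log n)})}{g(\log n)} = - \frac{x^{2}}{2\sigma^{2}}$ for all $x>0$ iff $\overline{\lambda}_{1} = \infty$; $\lim_{n\to\infty} \frac{\log \mathbb{P}(S_{n} - n \mu < - x \sqrt{n g(\log n)})}{g(\log n)} = - \frac{x^{2}}{2\sigma^{2}}$ for all $x>0$ iff $\overline{\lambda}_{2} = \infty$; and $\lim_{n\to\infty} \frac{\log \mathbb{P}(|S_{n} - n \mu| > x \sqrt{n g(\log n)})}{g(\log n)} = - \frac{x^{2}}{2\sigma^{2}}$ for all $x>0$ iff $\overline{\lambda} = \infty$.
   Context: For $\rho\ge 0$, $\mathcal{V}_{\rho}$ denotes the set of all nondecreasing functions $g:[0,\infty)\to[0,\infty)$ that are regularly varying at infinity with index $\rho$ (i.e. $\lim_{t\to\infty} g(xt)/g(t)=x^\rho$ for all $x>0$) and satisfy $\lim_{t\to\infty}g(t)=\infty$. $\log$ is the natural logarithm, with $\log 0=-\infty$; $a\wedge b=\min\{a,b\}$. The parameters (with values in $[0,\infty]$) are $\overline{\lambda}_{1} = - \limsup_{t \to \infty} \frac{\log (t^{2} \mathbb{P}(X > t ))}{g(\log t)}$, $\underline{\lambda}_{1} = - \liminf_{t \to \infty} \frac{\log (t^{2} \mathbb{P}(X > t ))}{g(\log t)}$, $\overline{\lambda}_{2} = - \limsup_{t \to \infty} \frac{\log (t^{2} \mathbb{P}(X < -t ))}{g(\log t)}$, $\underline{\lambda}_{2} = - \liminf_{t \to \infty} \frac{\log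 (t^{2} \mathbb{P}(X < -t ))}{g(\log t)}$, $\overline{\lambda} = - \limsup_{t \to \infty} \frac{\log (t^{2} \mathbb{P}(|X| > t ))}{g(\log t)}$, $\underline{\lambda} = - \liminf_{t \to \infty} \frac{\log (t^{2} \mathbb{P}(|X| > t ))}{g(\log t)}$. *)

(* Defs.v *)
From HB Require Import structures.
From mathcomp Require Import all_boot all_order all_algebra.
From mathcomp Require Import all_classical all_reals all_analysis.
Set Implicit Arguments. Unset Strict Implicit. Unset Printing Implicit Defensive.
Import Order.TTheory GRing.Theory Num.Def Num.Theory.
Import numFieldNormedType.Exports.
Local Open Scope classical_set_scope.
Local Open Scope ring_scope.

Section defs.
Variable R : realType.
Local Open Scope ereal_scope.

(* extended natural logarithm on [0,+oo], with log 0 = -oo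
   (negative arguments never occur; they are sent to -oo as well) *)
Definition elog (y : \bar R) : \bar R :=
  match y with
  | r%:E => if (r <= 0)%R then -oo else (ln r)%:E
  | +oo => +oo
  | -oo => -oo
  end.

(* the class V_rho: nondecreasing g : [0,oo) -> [0,oo), regularly varying at
   infinity with index rho, and tending to +oo.  g is given as a function
   R -> R; only its values on [0,oo) are constrained. *)
Definition regvar_class (rho : R) (g : R -> R) : Prop :=
  [/\ (forall s t : R, (0 <= s)%R -> (s <= t)%R -> (g s <= g t)%R),
      (forall t : R, (0 <= t)%R -> (0 <= g t)%R),
      (forall x : R, (0 < x)%R ->
          (g (x * t) / g t)%R @[t --> +oo%R] --> (x `^ rho)%R)
    & g t @[t --> +oo%R] --> +oo%R].

Definition tail_ratio (g : R -> R) (t : R) (p : \bar R) : \bar R :=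
  elog ((t ^+ 2)%:E * p) * ((g (ln t))^-1)%:E.

Definition seq_ratio (g : R -> R) (n : nat) (p : \bar R) : \bar R :=
  elog p * ((g (ln n%:R))^-1)%:E.

Definition rate (sigma2 rho x : R) (lam : \bar R) : \bar R :=
  Order.min ((x ^+ 2 / (2 * sigma2))%R)%:E (lam * ((2 `^ rho)^-1)%R%:E).

Variables (d : measure_display) (T : measurableType d) (P : probability T R).

(* {X_n} is an i.i.d. sequence: mutually independent (every finite family
   X_0,...,X_{n-1}; arbitrary subfamilies are obtained with B i = setT) and
   identically distributed as X_0 *)
Definition iid_seq (X : nat -> {RV P >-> R}) : Prop :=
  (forall (n : nat) (B : nat -> set R), (forall i, measurable (B i)) ->
     P (\bigcap_(i in `I_n) (X i @^-1` B i)) = \prod_(i < n) P (X i @^-1` B i))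
  /\ (forall (i : nat) (B : set R), measurable B ->
        P (X i @^-1` B) = P (X 0%N @^-1` B)).

Definition psum (X : nat -> {RV P >-> R}) (n : nat) (w : T) : R :=
  (\sum_(i < n) X i w)%R.

Definition lam_sup1 (g : R -> R) (Y : T -> R) : \bar R :=
  - limf_esup (fun t => tail_ratio g t (P [set w | (Y w > t)%R]))
              (pinfty_nbhs R).
Definition lam_inf1 (g : R -> R) (Y : T -> R) : \bar R :=
  - limf_einf (fun t => tail_ratio g t (P [set w | (Y w > t)%R]))
              (pinfty_nbhs R).
Definition lam_sup2 (g : R -> R) (Y : T -> R) : \bar R :=
  - limf_esup (fun t => tail_ratio g t (P [set w | (Y w < - t)%R]))
              (pinfty_nbhs R).
Definition lam_inf2 (g : R -> R) (Y : T -> R) : \bar R :=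
  - limf_einf (fun t => tail_ratio g t (P [set w | (Y w < - t)%R]))
              (pinfty_nbhs R).
Definition lam_sup (g : R -> R) (Y : T -> R) : \bar R :=
  - limf_esup (fun t => tail_ratio g t (P [set w | (`|Y w| > t)%R]))
              (pinfty_nbhs R).
Definition lam_inf (g : R -> R) (Y : T -> R) : \bar R :=
  - limf_einf (fun t => tail_ratio g t (P [set w | (`|Y w| > t)%R]))
              (pinfty_nbhs R).

Definition dev_up (g : R -> R) (X : nat -> {RV P >-> R}) (mu x : R) (n : nat)
  : \bar R :=
  seq_ratio g n (P [set w | (psum X n w - n%:R * mu >
                              x * Num.sqrt (n%:R * g (ln n%:R)))%R]).
Definition dev_down (g : R -> R) (X : nat -> {RV P >-> R}) (mu x : R) (n : nat)
  : \bar R :=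
  seq_ratio g n (P [set w | (psum X n w - n%:R * mu <
                              - (x * Num.sqrt (n%:R * g (ln n%:R))))%R]).
Definition dev_abs (g : R -> R) (X : nat -> {RV P >-> R}) (mu x : R) (n : nat)
  : \bar R :=
  seq_ratio g n (P [set w | (`|psum X n w - n%:R * mu| >
                              x * Num.sqrt (n%:R * g (ln n%:R)))%R]).

End defs.

(* Main.v *)
Require Import Defs.
From HB Require Import structures.
From mathcomp Require Import all_boot all_order all_algebra.
From mathcomp Require Import all_classical all_reals all_analysis.
From mathcomp Require Import measurable_realfun.
From mathcomp Require Import ring lra.
Set Implicit Arguments.
Unset Strict Implicit.
Import Order.TTheory GRing.Theory Num.Def Num.Theory.
Import numFieldNormedType.Exports.
Local Open Scope classical_set_scope.
Local Open Scope ring_scope.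

(** Write [G = g (ln n)], [a = sqrt (n / G)], [b = sqrt (n G)], and let [Y] be
    the centred variable, with variance [s2].
    Upper bound: discard the event that some [Y_i > K], of probability at most
    [n P(Y > K)], with [K] a small multiple of [b], and apply Chernoff's bound
    at [s = x / (s2 a)] to the variables truncated at [K]; the part of the
    truncated exponential moment above [c a] contributes at most
    [expR (kappa G) P(Y > c a)] per summand, with [kappa] as small as we like.
    Lower bounds: keep only the event that the summands are at most [eta a] in
    modulus, which costs a factor [expR (- o(G))].  There the exponential
    moments at [theta / a] are asymptotically Gaussian for every [theta], and
    comparing three of them localises the sum without a change of measure or a
    central limit theorem; one summand larger than [u b], the others being
    truncated, gives the contribution [n P(Y > u b)] of a single big jump.
    All of this needs independence only through the expectation of a product of
    nonnegative functions of the individual summands.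
    Since [ln a] and [ln b] are equivalent to [ln n / 2], regular variation
    turns [n P(Y > c a)] and [n P(Y > u b)] into the tail parameters divided by
    [2 `^ rho]; taking [c a] just above (resp. [u b] just below) a level [t]
    transfers an estimate valid only for arbitrarily large [t]. *)

(** Only two moments are finite, so exponential moments exist only after truncation. The scale [a]
    is dictated by [n / a ^ 2 = G]: an error [eps / a ^ 2] in the logarithm of one factor becomes
    [eps * G] in the product of [n] factors, hence [eps] after normalisation. A factor polynomial in
    [G] disappears likewise. Exchanging [n] for [t ^ 2], which costs a factor of order [G] at either
    scale, is therefore harmless, and the upper bound may live at scale [a] while the lower one
    lives at [b = a * G]. The lower bound for the limsup and the upper bound for the liminf know the
    tail only at sparse real levels [t], whereas sums are indexed by integers. Hence the comparisons
    are implications at a single [n], with free multiplicative constants in the levels. The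
    probabilistic content is condensed into [upper_estimate], [gauss_estimate] and [jump_estimate],
    where [H] and [D] are arbitrary functions. Their existential constants make them stable under
    translation by the mean and under addition, so the lower tail follows by a change of sign and
    the modulus by adding the two one-sided cases. *)

Section probability_prelim.
Context {R : realType} {d : measure_display} {T : measurableType d}.

Lemma measurable_gt_fun (V : T -> R) t : measurable_fun setT V ->
  measurable [set w | t < V w].
Proof.
move=> mV; rewrite -[X in measurable X]setTI -[X in _ `&` X](_ : V @^-1` `]t, +oo[ = _).
  exact: mV.
by apply/seteqP; split => w /=; rewrite in_itv/= andbT.
Qed.

Lemma le_fine_probability (P : probability T R) (A B : set T) :
  measurable A -> measurable B -> A `<=` B -> fine (P A) <= fine (P B).
Proof.
move=> mA mB AB; rewrite fine_le ?fin_num_measure//.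
by apply: le_measure; rewrite ?inE.
Qed.

End probability_prelim.

(** * Expectation of a product of independent factors *)

Section product.
Context {R : realType} {d d' : measure_display} {T : measurableType d}
  {T' : measurableType d'}.
Variable P : probability T R.
Import HBNNSimple.
Local Open Scope ereal_scope.

(** Here [c] stands for the mean of [W]. Both sides are monotone limits along the same simple
    approximations of [f], so agreement on indicators of [Z] suffices; this is the form that an
    induction on the factors can supply. *)
Lemma ge0_integral_mul_comp (W : T -> R) (Z : T -> T') (c : \bar R) :
  measurable_fun setT W -> measurable_fun setT Z ->
  (forall w, 0 <= W w)%R -> c \is a fin_num ->
  (forall B, measurable B ->
     \int[P]_w (\1_B (Z w) * W w)%:E = c * \int[P]_w (\1_B (Z w))%:E) ->
  forall f : T' -> R, measurable_fun setT f -> (forall x, 0 <= f x)%R ->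
    \int[P]_w (f (Z w) * W w)%:E = c * \int[P]_w (f (Z w))%:E.
Proof.
move=> mW mZ W0 cfin ind f mf f0.
have mEf : measurable_fun setT (EFin \o f) by exact/measurable_EFinP.
pose h := nnsfun_approx (@measurableT _ T') mEf.
have mono (V : T -> R) : measurable_fun setT V -> (forall w, 0 <= V w)%R ->
    \int[P]_w (f (Z w) * V w)%:E = limn (fun n => \int[P]_w (h n (Z w) * V w)%:E).
  move=> mV V0; rewrite -monotone_convergence//=.
  - apply: eq_integral => w _; apply/esym/cvg_lim => //.
    have hf : (h n (Z w))%:E @[n --> \oo] --> (f (Z w))%:E.
      exact: (@cvg_nnsfun_approx _ _ _ _ (@measurableT _ T') _ mEf
        (fun x _ => f0 x) (Z w) Logic.I).
    exact: (cvgeZr (isT : (V w)%:E \is a fin_num) hf).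
  - move=> n; apply/measurable_EFinP/measurable_funM => //.
    exact: measurableT_comp.
  - by move=> n w _; rewrite lee_fin mulr_ge0.
  - move=> w _ m n mn; rewrite lee_fin ler_wpM2r//.
    exact/lefP/nd_nnsfun_approx.
have simp (V : T -> R) n : measurable_fun setT V -> (forall w, 0 <= V w)%R ->
    \int[P]_w (h n (Z w) * V w)%:E =
    \sum_(y \in range (h n)) y%:E *
      \int[P]_w (\1_(h n @^-1` [set y]) (Z w) * V w)%:E.
  move=> mV V0.
  have mi y : measurable_fun setT
      (fun w => (\1_(h n @^-1` [set y]) (Z w) * V w)%:E).
    apply/measurable_EFinP/measurable_funM => //.
    by apply: measurableT_comp => //; exact: measurable_indic.
  transitivity (\int[P]_w (\sum_(y \in range (h n))
      (y * (\1_(h n @^-1` [set y]) (Z w) * V w))%:E)).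
    apply: eq_integral => w _; rewrite fimfunE fsumEFin//.
    by rewrite mulr_fsuml//; congr EFin; apply: eq_fsbigr => y _; rewrite mulrA.
  rewrite ge0_integral_fsum//; last 2 first.
  - by move=> y; under eq_fun do rewrite EFinM; exact: measurable_funeM.
  - move=> y w _; rewrite lee_fin mulrA mulr_ge0//.
    exact: (nnfun_muleindic_ge0 (h n) y (Z w)).
  apply: eq_fsbigr => y /set_mem [x _ <-].
  under eq_integral do rewrite EFinM.
  rewrite ge0_integralZl ?lee_fin//.
  by move=> w _; rewrite lee_fin mulr_ge0.
(* The right-hand integral is the left one with weight 1, so [mono] and [simp] treat both sides. *)
have m1 : measurable_fun setT (fun _ : T => 1%R : R) by [].
have eq1 (k : T' -> R) : \int[P]_w (k (Z w))%:E = \int[P]_w (k (Z w) * 1)%:E.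
  by apply: eq_integral => w _; rewrite mulr1.
rewrite (mono W)// (eq1 f) (mono (fun=> 1%R))//.
have -> : c * limn (fun n => \int[P]_w (h n (Z w) * 1)%:E) =
    limn (fun n => c * \int[P]_w (h n (Z w) * 1)%:E).
  rewrite limeMl//; apply: ereal_nondecreasing_is_cvgn => m n mn.
  apply: ge0_le_integral => //.
  - by move=> w _; rewrite lee_fin mulr_ge0.
  - by apply/measurable_EFinP/measurable_funM => //; exact: measurableT_comp.
  - by apply/measurable_EFinP/measurable_funM => //; exact: measurableT_comp.
  - by move=> w _; rewrite lee_fin ler_wpM2r//; exact/lefP/nd_nnsfun_approx.
apply: congr_lim; apply/funext => n.
rewrite (simp W)// (simp (fun=> 1%R))// ge0_mule_fsumr.
  apply: eq_fsbigr => y _; rewrite ind// -(eq1 (\1_(h n @^-1` [set y]))) muleCA.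
  by [].
(* Moving [c] inside the finite sum asks for nonnegative terms; a negative [y] has an empty preimage
   under [h n]. *)
move=> y; have [y0|y0] := leP 0%R y.
  by rewrite mule_ge0 ?lee_fin// integral_ge0// => w _; rewrite lee_fin mulr_ge0.
rewrite preimage_nnfun0//; under eq_integral do rewrite indic0 mul0r.
by rewrite integral0 mule0.
Qed.

End product.

Section independent_product.
Context {R : realType} {d d' : measure_display} {T : measurableType d}
  {T' : measurableType d'}.
Variables (P : probability T R) (Y : nat -> T -> T').
Hypothesis mY : forall i, measurable_fun setT (Y i).
Hypothesis indepY : forall (n : nat) (B : nat -> set T'),
  (forall i, measurable (B i)) ->
  P (\bigcap_(i in `I_n) (Y i @^-1` B i)) = (\prod_(i < n) P (Y i @^-1` B i))%E.
Local Open Scope ereal_scope.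

Let prod_indic (n : nat) (B : nat -> set T') (w : T) :
  (\prod_(i < n) \1_(B i) (Y i w))%R =
  \1_(\bigcap_(i in `I_n) (Y i @^-1` B i)) w :> R.
Proof.
rewrite [RHS]indicE; have [wB|wB] := boolP (w \in _).
  rewrite big1// => i _; rewrite indicE mem_set//.
  by move/set_mem : wB => /(_ i)/=; apply.
move/negP : wB => wB.
have [i iB] : exists i : 'I_n, ~ B i (Y i w).
  apply/not_existsP => h; apply: wB; apply/mem_set => i /= ni.
  by have := h (Ordinal ni); rewrite notE.
by rewrite (bigD1 i)//= indicE memNset// mul0r.
Qed.

Lemma integral_prod_indep (n : nat) (f : nat -> T' -> R) :
  (forall i, measurable_fun setT (f i)) -> (forall i x, 0 <= f i x)%R ->
  (forall i, \int[P]_w (f i (Y i w))%:E \is a fin_num) ->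
  \int[P]_w (\prod_(i < n) f i (Y i w))%:E = \prod_(i < n) \int[P]_w (f i (Y i w))%:E.
Proof.
have indfin (B : set T') i : measurable B ->
    \int[P]_w (\1_B (Y i w))%:E = P (Y i @^-1` B).
  move=> mB; rewrite -(setIT (_ @^-1` _)) -integral_indic//.
  by rewrite -[X in measurable X]setTI; exact: mY.
(* replace the indicators by general functions one index at a time *)
suff H k : forall f : nat -> T' -> R,
    (forall i, measurable_fun setT (f i)) -> (forall i x, 0 <= f i x)%R ->
    (forall i, \int[P]_w (f i (Y i w))%:E \is a fin_num) ->
    (forall i, (k <= i)%N -> exists2 B, measurable B & f i = \1_B) ->
    \int[P]_w (\prod_(i < n) f i (Y i w))%:E =
    \prod_(i < n) \int[P]_w (f i (Y i w))%:E.
  move=> mf f0 ffin.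
  (* Padding: positions from [n] on do not occur in the product, so they may be set to the constant
     1, an indicator, as [H n] demands. *)
  pose f' i := if (i < n)%N then f i else \1_setT.
  transitivity (\int[P]_w (\prod_(i < n) f' i (Y i w))%:E).
    apply: eq_integral => w _; congr EFin; apply: eq_bigr => i _.
    by rewrite /f' ltn_ord.
  rewrite (H n f'); rewrite /f'.
  - by apply: eq_bigr => i _; rewrite ltn_ord.
  - by move=> i; case: ifPn.
  - by move=> i x; case: ifPn.
  - move=> i; case: ifPn => // _.
    by rewrite indfin// fin_num_measure// -[X in measurable X]setTI; exact: mY.
  - by move=> i; rewrite leqNgt => /negbTE ->; exists setT.
elim: k => [|k IH] {}f mf f0 ffin find.
  have /choice [B BP] : forall i, exists B : set T', measurable B /\ f i = \1_B.
    move=> i.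
    by have [B mB fB] := find i (leq0n _); exists B.
  have fB i : f i = \1_(B i) by case: (BP i).
  have mB i : measurable (B i) by case: (BP i).
  under eq_integral do under eq_bigr do rewrite fB.
  under eq_integral do rewrite prod_indic.
  have mcap : measurable (\bigcap_(i in `I_n) (Y i @^-1` B i)).
    apply: bigcap_measurableType => i _.
    by rewrite -[X in measurable X]setTI; exact: mY.
  rewrite integral_indic// setIT; apply: etrans (indepY n mB) _.
  by apply: eq_bigr => i _; rewrite fB indfin.
have [nk|kn] := leqP n k.
  pose f' i := if (i < n)%N then f i else \1_setT.
  transitivity (\int[P]_w (\prod_(i < n) f' i (Y i w))%:E).
    apply: eq_integral => w _; congr EFin; apply: eq_bigr => i _.
    by rewrite /f' ltn_ord.
  rewrite (IH f'); rewrite /f'.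
  - by apply: eq_bigr => i _; rewrite ltn_ord.
  - by move=> i; case: ifPn.
  - by move=> i x; case: ifPn.
  - move=> i; case: ifPn => // _.
    by rewrite indfin// fin_num_measure// -[X in measurable X]setTI; exact: mY.
  - by move=> i ki; rewrite ltnNge (leq_trans nk)//; exists setT.
pose ok := Ordinal kn.
rewrite (bigD1 ok)//=.
under eq_integral do rewrite (bigD1 ok)//=.
rewrite muleC.
(* Factor [k] is the one to generalise. With [\1_B] in its place the induction hypothesis applies
   and yields exactly the identity on indicators asked for here. *)
apply: (@ge0_integral_mul_comp _ _ _ _ _ P
  (fun w => \prod_(i < n | i != ok) f i (Y i w))%R (Y k)) => //.
- under eq_fun do rewrite big_mkcond/=.
  apply: measurable_prod => i _; case: (i != ok) => //.
  exact: measurableT_comp.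
- by move=> w; apply: prodr_ge0.
- by apply: (big_ind (fun x => x \is a fin_num)) => // x y; exact: fin_numM.
move=> B mB; pose f' i := if i == k then \1_B else f i.
have f'k : f' k = \1_B by rewrite /f' eqxx.
have f'E (i : 'I_n) : i != ok -> f' i = f i.
  by move=> ik; rewrite /f' ifN.
transitivity (\int[P]_w (\prod_(i < n) f' i (Y i w))%:E).
  apply: eq_integral => w _; congr EFin; rewrite [RHS](bigD1 ok)//= f'k.
  by congr (_ * _)%R; apply: eq_bigr => i ik; rewrite f'E.
rewrite (IH f').
- rewrite (bigD1 ok)//= f'k muleC; congr (_ * _).
  by apply: eq_bigr => i ik; rewrite f'E.
- by move=> i; rewrite /f'; case: ifPn.
- by move=> i x; rewrite /f'; case: ifPn.
- move=> i; rewrite /f'; case: ifPn => // _.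
  by rewrite indfin// fin_num_measure// -[X in measurable X]setTI; exact: mY.
- move=> i ki; rewrite /f'; case: ifPn => [_|ik]; first by exists B.
  by apply: find; rewrite ltn_neqAle eq_sym ik.
Qed.

Lemma ge0_integral_eq_distribution (i j : nat) (f : T' -> R) :
  (forall B, measurable B -> P (Y i @^-1` B) = P (Y j @^-1` B)) ->
  measurable_fun setT f -> (forall x, 0 <= f x)%R ->
  \int[P]_w (f (Y i w))%:E = \int[P]_w (f (Y j w))%:E.
Proof.
move=> eqd mf f0.
have E k : \int[P]_w (f (Y k w))%:E = \int[pushforward P (Y k)]_y (f y)%:E.
  rewrite ge0_integral_pushforward//.
  - exact/measurable_EFinP.
  - by move=> y; rewrite lee_fin.
rewrite !E; apply: eq_measure_integral => A mA _; exact: eqd.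
Qed.

End independent_product.

(** * Exponential moments of truncated variables *)

Section exponential_taylor.
Context {R : realType}.
Implicit Types x y z : R.

Let is_derive_taylor2 (c x : R) :
  is_derive x 1 (fun z => expR z - (1 + z + z ^+ 2 / 2 + c * z ^+ 3))
    (expR x - (1 + x + c * (3 * x ^+ 2))).
Proof.
have did := is_derive_id x (1 : R).
have h := is_deriveB (is_derive_expR x) (is_deriveD (is_deriveD (is_deriveD
  (is_derive_cst (1 : R) x 1) did) (is_deriveZ 2^-1 (is_deriveX 2 did)))
  (is_deriveZ c (is_deriveX 3 did))).
move: h; set F := (X in is_derive _ _ X _); set l := (X in is_derive _ _ _ X) => h.
have -> : (fun z => expR z - (1 + z + z ^+ 2 / 2 + c * z ^+ 3)) = F.
  by apply/funext => z; rewrite /F !fctE /= /GRing.scale/= [2^-1 * _]mulrC.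
suff <- : l = expR x - (1 + x + c * (3 * x ^+ 2)) by [].
rewrite /l; clear; rewrite /GRing.scale /= !mulr1 add0r; lra.
Qed.

Let taylor2_MVT (c x y : R) : x <= y -> exists2 z, x <= z <= y &
  expR y - (1 + y + y ^+ 2 / 2 + c * y ^+ 3) -
    (expR x - (1 + x + x ^+ 2 / 2 + c * x ^+ 3)) =
  (expR z - (1 + z + c * (3 * z ^+ 2))) * (y - x).
Proof.
move=> xy; have dv u : derivable
    (fun z => expR z - (1 + z + z ^+ 2 / 2 + c * z ^+ 3)) u 1.
  by case: (is_derive_taylor2 c u).
have [z zxy E] := @MVT_segment R _ _ x y xy (fun u _ => is_derive_taylor2 c u)
  (derivable_within_continuous (fun u _ => dv u)).
by exists z; first by move: zxy; rewrite in_itv.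
Qed.

(** One mean value identity for four inequalities: [c = 0] compares [expR] with its quadratic
    polynomial, [c = 1] with that polynomial plus the cube. The sign of the bracket at [z] decides
    the direction. *)
Let taylor2 (c y : R) : exists z,
  [/\ 0 <= y -> 0 <= z <= y, y <= 0 -> y <= z <= 0 &
   expR y = 1 + y + y ^+ 2 / 2 + c * y ^+ 3 +
     (expR z - (1 + z + c * (3 * z ^+ 2))) * y].
Proof.
have E0 : 1 + 0 + 0 ^+ 2 / 2 + c * 0 ^+ 3 = 1 :> R.
  by rewrite !expr0n/= mul0r mulr0 !addr0.
have [y0|y0] := leP 0 y.
  have [z /andP[z0 zy]] := taylor2_MVT c y0.
  rewrite expR0 E0 subrr !subr0 => E; exists z; split; [by rewrite z0 zy|move=> ?; lra|].
  by rewrite -E; ring.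
have [z /andP[yz z0]] := taylor2_MVT c (ltW y0).
rewrite expR0 E0 subrr !sub0r => E; exists z; split; [move=> ?; lra|by rewrite yz z0|].
have -> : expR y = - (- (expR y - (1 + y + y ^+ 2 / 2 + c * y ^+ 3))) +
  (1 + y + y ^+ 2 / 2 + c * y ^+ 3) by ring.
by rewrite E; ring.
Qed.

Lemma expR_ge_taylor2 x : 0 <= x -> 1 + x + x ^+ 2 / 2 <= expR x.
Proof.
move=> x0; have [z [_ _ ->]] := taylor2 0 x.
have : 0 <= (expR z - (1 + z)) * x by rewrite mulr_ge0// subr_ge0 expR_ge1Dx.
lra.
Qed.

Lemma expR_le_taylor2 x : x <= 0 -> expR x <= 1 + x + x ^+ 2 / 2.
Proof.
move=> x0; have [z [_ _ ->]] := taylor2 0 x.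
have : (expR z - (1 + z)) * x <= 0.
  by rewrite mulr_ge0_le0// subr_ge0 expR_ge1Dx.
lra.
Qed.

(** The sign of the bracket of [taylor2] at [c = 1]. For positive [x] it follows from
    [(1 - x) * expR x <= 1], and the threshold 1/2 makes [(1 - x) * (1 + x + 3 * x ^ 2)] at least 1;
    every later bound [zeta <= 1 / 2] originates here. *)
Let expR_le_quadratic x : x <= 1 / 2 -> expR x <= 1 + x + 3 * x ^+ 2.
Proof.
move=> x1; have [x0|x0] := leP x 0.
  by have := expR_le_taylor2 x0; have := sqr_ge0 x; lra.
have e0 : 0 < expR x := expR_gt0 x.
have : (1 - x) * expR x <= 1.
  by rewrite -ler_pdivlMr// div1r -expRN; exact: expR_ge1Dx.
have x20 : 0 <= x ^+ 2 by exact: sqr_ge0.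
have : 0 <= x ^+ 2 * (1 / 2 - x) by rewrite mulr_ge0//; lra.
move=> h1 h2; have x1' : 0 < 1 - x by lra.
rewrite -(ler_pM2l x1'); apply: le_trans h2 _.
rewrite (_ : (1 - x) * (1 + x + 3 * x ^+ 2) =
  1 + x ^+ 2 / 2 + 3 * (x ^+ 2 * (1 / 2 - x))); [lra|by field].
Qed.

Lemma expR_taylor2_le x : 0 <= x <= 1 / 2 ->
  expR x <= 1 + x + x ^+ 2 / 2 + x ^+ 3.
Proof.
move=> /andP[x0 x1]; have [z [/(_ x0)/andP[z0 zx] _ ->]] := taylor2 1 x.
have : (expR z - (1 + z + 3 * z ^+ 2)) * x <= 0.
  rewrite mulr_le0_ge0// subr_le0 expR_le_quadratic//; lra.
lra.
Qed.

Lemma expR_taylor2_ge x : x <= 0 -> 1 + x + x ^+ 2 / 2 + x ^+ 3 <= expR x.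
Proof.
move=> x0; have [z [_ /(_ x0)/andP[xz z0] ->]] := taylor2 1 x.
have : 0 <= (expR z - (1 + z + 3 * z ^+ 2)) * x.
  rewrite mulr_le0// subr_le0 expR_le_quadratic//; lra.
lra.
Qed.

Lemma dist_expR_taylor2 (zeta x : R) : zeta <= 1 / 2 -> `|x| <= zeta ->
  `|expR x - (1 + x + x ^+ 2 / 2)| <= zeta * x ^+ 2.
Proof.
move=> z1; rewrite ler_norml => /andP[zx xz]; rewrite ler_norml.
have x20 : 0 <= x ^+ 2 by exact: sqr_ge0.
have a0 : 0 <= x ^+ 2 * (zeta - x) by rewrite mulr_ge0//; lra.
have b0 : 0 <= x ^+ 2 * (zeta + x) by rewrite mulr_ge0//; lra.
have [x0|x0] := leP 0 x.
- have := expR_ge_taylor2 x0; have : expR x <= 1 + x + x ^+ 2 / 2 + x ^+ 3.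
    by apply: expR_taylor2_le; lra.
  have c0 : 0 <= zeta * x ^+ 2 by rewrite mulr_ge0//; lra.
  by rewrite exprS; lra.
- have := expR_le_taylor2 (ltW x0); have := expR_taylor2_ge (ltW x0).
  have c0 : 0 <= zeta * x ^+ 2 by rewrite mulr_ge0//; lra.
  by rewrite exprS; lra.
Qed.

(** All negative [x] are covered, since there the quadratic already dominates; hence truncating from
    above is enough for the upper bound. *)
Lemma expR_le_taylor2_dist (zeta x : R) : 0 <= zeta <= 1 / 2 -> x <= zeta ->
  expR x <= 1 + x + (1 / 2 + zeta) * x ^+ 2.
Proof.
move=> /andP[z0 z1] xz; have x20 : 0 <= x ^+ 2 by exact: sqr_ge0.
have a0 : 0 <= x ^+ 2 * (zeta - x) by rewrite mulr_ge0//; lra.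
have c0 : 0 <= zeta * x ^+ 2 by rewrite mulr_ge0//; lra.
have [x0|x0] := leP 0 x.
- have : expR x <= 1 + x + x ^+ 2 / 2 + x ^+ 3 by apply: expR_taylor2_le; lra.
  by rewrite [x ^+ 3]exprS; lra.
- by have := expR_le_taylor2 (ltW x0); lra.
Qed.

(** The bound [ln (1 + y) >= y - 2 * y ^ 2] in exponential form; it converts lower bounds on a
    moment into lower bounds on its powers. *)
Lemma expR_subr_le1Dx (eps y : R) : - (1 / 2) <= y -> 2 * y ^+ 2 <= eps ->
  expR (y - eps) <= 1 + y.
Proof.
move=> y1 ye; rewrite -(opprB eps y) expRN.
rewrite -[leRHS]invrK lef_pV2 ?posrE ?expR_gt0 ?invr_gt0//; last lra.
apply: le_trans (expR_ge1Dx _); rewrite -div1r ler_pdivrMr; last lra.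
nra.
Qed.

End exponential_taylor.

Section truncated_moments.
Context {R : realType} {d : measure_display} {T : measurableType d}.
Variable P : probability T R.
Local Notation Lint f := (P.-integrable setT (EFin \o f)).
Implicit Types f g Z : T -> R.

Lemma integrable_le_real f g : measurable_fun setT f ->
  (forall w, `|f w| <= g w) -> Lint g -> Lint f.
Proof.
move=> mf fg ig; apply: le_integrable ig => //; first exact/measurable_EFinP.
move=> w _ /=; rewrite lee_fin; apply: le_trans (fg w) _; exact: ler_norm.
Qed.

Lemma integrable_bounded_real f (M : R) : measurable_fun setT f ->
  (forall w, `|f w| <= M) -> Lint f.
Proof.
move=> mf fM; apply: (@integrable_le_real _ (fun=> M)) => //.
have /finite_measure_integrable_cst := @measurableT _ T.
by apply.
Qed.

Lemma integrable_addr f g : Lint f -> Lint g -> Lint (fun w => f w + g w).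
Proof. by move=> lf lg; apply: eq_integrable (integrableD _ lf lg). Qed.

Lemma integrable_scaler (k : R) f : Lint f -> Lint (fun w => k * f w).
Proof. by move=> lf; apply: eq_integrable (integrableZl _ k lf). Qed.

Lemma Rintegral_probability_indic (A : set T) : measurable A ->
  \int[P]_w (\1_A w) = fine (P A).
Proof. by move=> mA; rewrite /Rintegral integral_indic// setIT. Qed.

(** The value beyond the truncation level is 0 and not 1, so that a product of such factors is the
    exponential of the sum on the event that all summands are truncated, and vanishes off it. *)
Definition trunc_exp (s tau y : R) := if `|y| <= tau then expR (s * y) else 0.
Definition upper_trunc_exp (s K y : R) := if y <= K then expR (s * y) else 0.
Definition tail_sqr (tau y : R) := if tau < `|y| then y ^+ 2 else 0.

Lemma measurable_trunc_exp s tau : measurable_fun setT (trunc_exp s tau).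
Proof.
apply: measurable_fun_ifT => //; first exact: measurable_fun_ler.
by apply: measurableT_comp => //; exact: measurable_funM.
Qed.

Lemma measurable_upper_trunc_exp s K : measurable_fun setT (upper_trunc_exp s K).
Proof.
apply: measurable_fun_ifT => //; first exact: measurable_fun_ler.
by apply: measurableT_comp => //; exact: measurable_funM.
Qed.

Lemma measurable_tail_sqr tau : measurable_fun setT (tail_sqr tau).
Proof.
apply: measurable_fun_ifT => //; exact: measurable_fun_ltr.
Qed.

Lemma trunc_exp_ge0 s tau y : 0 <= trunc_exp s tau y.
Proof. by rewrite /trunc_exp; case: ifP => // _; exact: expR_ge0. Qed.

Lemma upper_trunc_exp_ge0 s K y : 0 <= upper_trunc_exp s K y.
Proof. by rewrite /upper_trunc_exp; case: ifP => // _; exact: expR_ge0. Qed.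

Lemma trunc_exp_bounded s tau y : `|trunc_exp s tau y| <= expR (`|s| * tau).
Proof.
rewrite ger0_norm ?trunc_exp_ge0// /trunc_exp; case: ifP => ytau.
  rewrite ler_expR; apply: le_trans (ler_norm _) _.
  by rewrite normrM ler_wpM2l.
exact: expR_ge0.
Qed.

Lemma upper_trunc_exp_bounded s K y : 0 <= s ->
  `|upper_trunc_exp s K y| <= expR (s * K).
Proof.
move=> s0; rewrite ger0_norm ?upper_trunc_exp_ge0// /upper_trunc_exp.
by case: ifP => yK; rewrite ?expR_ge0// ler_expR ler_wpM2l.
Qed.

(** Up to [tau] this is the Taylor error. Beyond [tau] the truncated exponential is 0 and the three
    terms of the polynomial are each turned into a multiple of [y ^ 2], by [1 <= (y / tau) ^ 2] and
    [|y| <= y ^ 2 / tau]. *)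
Lemma dist_trunc_exp (s tau zeta y : R) :
  0 < tau -> zeta <= 1 / 2 -> `|s| * tau <= zeta ->
  `|trunc_exp s tau y - (1 + s * y + s ^+ 2 / 2 * y ^+ 2)| <=
  zeta * s ^+ 2 * y ^+ 2 +
    (tau^-1 ^+ 2 + `|s| * tau^-1 + s ^+ 2 / 2) * tail_sqr tau y.
Proof.
move=> tau0 z1 st; rewrite /trunc_exp /tail_sqr.
have z0 : 0 <= zeta by apply: le_trans st; rewrite mulr_ge0// ltW.
have [ytau|tauy] := leP `|y| tau.
  rewrite mulr0 addr0.
  have -> : zeta * s ^+ 2 * y ^+ 2 = zeta * (s * y) ^+ 2 by ring.
  have -> : s ^+ 2 / 2 * y ^+ 2 = (s * y) ^+ 2 / 2 by field.
  apply: dist_expR_taylor2 => //.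
  by rewrite normrM; apply: le_trans st; rewrite ler_wpM2l.
have t1 : 1 <= tau^-1 * `|y| by rewrite mulrC ler_pdivlMr// mul1r ltW.
have y2 : y ^+ 2 = `|y| ^+ 2 by rewrite real_normK// num_real.
have s2 : s ^+ 2 = `|s| ^+ 2 by rewrite real_normK// num_real.
rewrite sub0r normrN.
apply: (@le_trans _ _ (1 + `|s| * `|y| + s ^+ 2 / 2 * y ^+ 2)).
  rewrite (le_trans (ler_normD _ _))// (ger0_norm (_ : 0 <= s ^+ 2 / 2 * _)); last first.
    by rewrite mulr_ge0 ?divr_ge0 ?sqr_ge0.
  by rewrite lerD2r (le_trans (ler_normD _ _))// normr1 normrM.
have h1 : 1 <= tau^-1 ^+ 2 * y ^+ 2 by rewrite y2 -exprMn exprn_ege1.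
have h2 : `|s| * `|y| <= `|s| * tau^-1 * y ^+ 2.
  rewrite y2 expr2 -mulrA ler_wpM2l// mulrA ler_peMl//.
have h3 : 0 <= zeta * s ^+ 2 * y ^+ 2.
  by rewrite mulr_ge0 ?sqr_ge0// mulr_ge0 ?sqr_ge0.
lra.
Qed.

(** Two levels: up to [c], where [s * y <= zeta], the quadratic bound holds; between [c] and [K]
    only the crude bound [expR (s * K)] remains, paid for by the tail at [c]. *)
Lemma upper_trunc_exp_le (s c K zeta y : R) : 0 <= s -> s * c = zeta ->
  0 <= zeta <= 1 / 2 ->
  upper_trunc_exp s K y <= 1 + s * y + (1 / 2 + zeta) * s ^+ 2 * y ^+ 2 +
    expR (s * K) * (if c < y then 1 else 0).
Proof.
move=> s0 sc z01; have [z0 z1] := andP z01; rewrite /upper_trunc_exp.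
have E : (1 / 2 + zeta) * s ^+ 2 * y ^+ 2 = (1 / 2 + zeta) * (s * y) ^+ 2.
  by ring.
have [yc|cy] := leP y c.
  rewrite mulr0 addr0 E.
  have h : expR (s * y) <= 1 + s * y + (1 / 2 + zeta) * (s * y) ^+ 2.
    by apply: expR_le_taylor2_dist => //; rewrite -sc ler_wpM2l.
  by case: ifP => // _; apply: le_trans h; exact: expR_ge0.
have ey : 0 <= expR (s * K) := expR_ge0 _.
rewrite mulr1 E.
have h : 0 <= 1 + s * y + (1 / 2 + zeta) * (s * y) ^+ 2.
  have h1 : zeta <= s * y by rewrite -sc ler_wpM2l// ltW.
  have h2 : 0 <= (1 / 2 + zeta) * (s * y) ^+ 2 by rewrite mulr_ge0 ?sqr_ge0//; lra.
  lra.
case: ifP => [yK|_]; last lra.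
have : expR (s * y) <= expR (s * K) by rewrite ler_expR ler_wpM2l.
lra.
Qed.

Variables (Z : T -> R) (s2 : R).
Hypotheses (mZ : measurable_fun setT Z) (iZ : Lint Z)
  (iZ2 : Lint (fun w => Z w ^+ 2)).
Hypotheses (EZ : \int[P]_w (Z w) = 0) (EZ2 : \int[P]_w (Z w ^+ 2) = s2).

Let mZ2 : measurable_fun setT (fun w => Z w ^+ 2).
Proof. exact: measurable_funX. Qed.

Lemma integrable_tail_sqr tau : Lint (fun w => tail_sqr tau (Z w)).
Proof.
apply: integrable_le_real iZ2.
  exact: (measurableT_comp (measurable_tail_sqr tau)).
move=> w; rewrite /tail_sqr; case: ifP => _; last by rewrite normr0 sqr_ge0.
by rewrite ger0_norm ?sqr_ge0.
Qed.

Lemma integrable_trunc_exp s tau : Lint (fun w => trunc_exp s tau (Z w)).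
Proof.
apply: (@integrable_bounded_real _ (expR (`|s| * tau))).
  exact: (measurableT_comp (measurable_trunc_exp s tau)).
by move=> w; exact: trunc_exp_bounded.
Qed.

Lemma integrable_upper_trunc_exp s K : 0 <= s ->
  Lint (fun w => upper_trunc_exp s K (Z w)).
Proof.
move=> s0; apply: (@integrable_bounded_real _ (expR (s * K))).
  exact: (measurableT_comp (measurable_upper_trunc_exp s K)).
by move=> w; exact: upper_trunc_exp_bounded.
Qed.

Let integrable_taylor (k1 k2 : R) : Lint (fun w => 1 + k1 * Z w + k2 * Z w ^+ 2).
Proof.
apply: integrable_addr; last exact: integrable_scaler.
apply: integrable_addr; last exact: integrable_scaler.
by apply: (@integrable_bounded_real _ 1) => // w; rewrite normr1.
Qed.

Let integral_taylor (k1 k2 : R) :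
  \int[P]_w (1 + k1 * Z w + k2 * Z w ^+ 2) = 1 + k2 * s2.
Proof.
have i1 : Lint (fun=> 1).
  by apply: (@integrable_bounded_real _ 1) => // w; rewrite normr1.
rewrite RintegralD//; last 2 first.
- by apply: integrable_addr => //; exact: integrable_scaler.
- exact: integrable_scaler.
rewrite RintegralD//; last exact: integrable_scaler.
rewrite RintegralZl// RintegralZl// EZ EZ2 mulr0 addr0 Rintegral_cst//.
by rewrite [X in fine X]probability_setT mulr1.
Qed.

(** Finiteness of the second moment enters here: dominated convergence along integers, then
    monotonicity in [tau]. *)
Lemma tail_sqr_cvg0 (eps : R) : 0 < eps -> exists2 tau0, 0 < tau0 &
  forall tau, tau0 <= tau -> \int[P]_w (tail_sqr tau (Z w)) <= eps.
Proof.
move=> eps0.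
have H1 : {ae P, forall w, setT w -> (tail_sqr n%:R (Z w))%:E @[n --> \oo] --> cst 0%E w}.
  apply: aeW => w _; apply: cvg_near_cst; near=> n.
  rewrite /tail_sqr ltNge (_ : `|Z w| <= n%:R)//.
  by near: n; exact: nbhs_infty_ger.
have H2 : {ae P, forall w n, setT w -> (`|(tail_sqr n%:R (Z w))%:E| <= (Z w ^+ 2)%:E)%E}.
  apply: aeW => w n _; rewrite /= lee_fin /tail_sqr.
  case: ifP => _; last by rewrite normr0 sqr_ge0.
  by rewrite ger0_norm ?sqr_ge0.
have [_ _] := @dominated_convergence _ _ _ P setT measurableT
  (fun n w => (tail_sqr n%:R (Z w))%:E) (cst 0%E) (fun w => (Z w ^+ 2)%:E)
  (fun n => (measurable_EFinP _ _).2
     (measurableT_comp (measurable_tail_sqr n%:R) mZ))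
  (measurable_cst _) H1 iZ2 H2.
rewrite integral0 => cv.
have cvR : \int[P]_w (tail_sqr n%:R (Z w)) @[n --> \oo] --> (0 : R).
  exact: (fine_cvg cv).
have [N _ HN] := cvgr_le _ cvR _ eps0.
exists N.+1%:R => // tau Ntau.
apply: le_trans (HN N.+1 (leqnSn N)).
apply: le_Rintegral => //; [exact: integrable_tail_sqr..|].
move=> w _; rewrite /tail_sqr; have [/(le_lt_trans Ntau) -> //|_] := ltP tau _.
by case: ifP; rewrite ?sqr_ge0.
Unshelve. all: by end_near. Qed.

(** The order of the quantifiers reflects two errors. The Taylor error is proportional to [eta]; the
    error beyond [eta * a] has a coefficient that blows up as [eta] shrinks, but tends to 0 as [a]
    grows with [eta] fixed. *)
Lemma trunc_mgf (theta eps : R) : 0 < eps -> exists2 eta0, 0 < eta0 &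
  forall eta, 0 < eta <= eta0 -> exists2 a0, 0 < a0 & forall a, a0 <= a ->
    `|\int[P]_w (trunc_exp (theta / a) (eta * a) (Z w)) -
      (1 + theta ^+ 2 * s2 / 2 / a ^+ 2)| <= eps / a ^+ 2.
Proof.
move=> eps0.
have s20 : 0 <= s2 by rewrite -EZ2; apply: Rintegral_ge0 => w _; exact: sqr_ge0.
(* The single condition [eta * D <= 1] gives both [zeta <= 1 / 2] and
   [zeta * theta ^ 2 * s2 <= eps / 2], for [zeta = |theta| * eta]. *)
pose D := 2 * (1 + `|theta| + `|theta| ^+ 3 * s2 / eps).
have D3 : 0 <= `|theta| ^+ 3 * s2 / eps.
  by rewrite !mulr_ge0 ?invr_ge0 ?exprn_ge0// ltW.
have D0 : 0 < D by rewrite /D; have := normr_ge0 theta; lra.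
exists D^-1; first by rewrite invr_gt0.
move=> eta /andP[eta0 etaD].
(* This is [a ^ 2] times the coefficient of [tail_sqr] in [dist_trunc_exp] at [s = theta / a] and
   [tau = eta * a]. *)
pose C := eta^-1 ^+ 2 + `|theta| * eta^-1 + theta ^+ 2 / 2.
have C0 : 0 < C.
  rewrite /C -addrA ltr_pwDl ?exprn_gt0 ?invr_gt0// addr_ge0// mulr_ge0//.
  by rewrite invr_ge0 ltW.
  by rewrite sqr_ge0.
have eC : 0 < eps / 2 / C by rewrite !divr_gt0.
have [tau0 tau00 Htau] := tail_sqr_cvg0 eC.
exists (tau0 / eta); first by rewrite divr_gt0.
move=> a Ha; have a0 : 0 < a by apply: lt_le_trans Ha; rewrite divr_gt0.
set s := theta / a; set tau := eta * a.
have tau_gt0 : 0 < tau by rewrite mulr_gt0.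
pose zeta := `|theta| * eta.
have sE : `|s| * tau = zeta.
  rewrite /s /tau normrM normfV (gtr0_norm a0) /zeta; field; lra.
have etaDle : eta * D <= 1 by rewrite -ler_pdivlMr// div1r.
have th0 := normr_ge0 theta.
have zeta1 : zeta <= 1 / 2.
  rewrite /zeta; have : 0 <= eta * (`|theta| ^+ 3 * s2 / eps).
    by rewrite mulr_ge0// ltW.
  by move: etaDle; rewrite /D; lra.
have zeta2 : zeta * theta ^+ 2 * s2 <= eps / 2.
  have : eta * (`|theta| ^+ 3 * s2 / eps) <= 1 / 2.
    have : 0 <= eta * (1 + `|theta|) by rewrite mulr_ge0// ?ltW//; lra.
    by move: etaDle; rewrite /D; lra.
  rewrite mulrA ler_pdivrMr// => h.
  have -> : zeta * theta ^+ 2 * s2 = eta * (`|theta| ^+ 3 * s2).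
    by rewrite /zeta -(@real_normK _ theta) ?num_real//; ring.
  lra.
have q1 : \int[P]_w (tail_sqr tau (Z w)) <= eps / 2 / C.
  by apply: Htau; rewrite /tau mulrC -ler_pdivrMr.
have -> : 1 + theta ^+ 2 * s2 / 2 / a ^+ 2 =
    \int[P]_w (1 + s * Z w + s ^+ 2 / 2 * Z w ^+ 2).
  rewrite integral_taylor /s; field; lra.
rewrite -(RintegralB measurableT (integrable_trunc_exp s tau)
  (integrable_taylor s (s ^+ 2 / 2))).
have iD : Lint (fun w => trunc_exp s tau (Z w) - (1 + s * Z w + s ^+ 2 / 2 * Z w ^+ 2)).
  apply: eq_integrable (integrableB _ (integrable_trunc_exp s tau) (integrable_taylor s (s ^+ 2 / 2))) => //.
apply: le_trans (le_normr_Rintegral _ iD) _ => //.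
have iB : Lint (fun w => zeta * s ^+ 2 * Z w ^+ 2 +
    (tau^-1 ^+ 2 + `|s| * tau^-1 + s ^+ 2 / 2) * tail_sqr tau (Z w)).
  apply: integrable_addr; apply: integrable_scaler => //.
  exact: integrable_tail_sqr.
apply: (@le_trans _ _ (\int[P]_w (zeta * s ^+ 2 * Z w ^+ 2 +
    (tau^-1 ^+ 2 + `|s| * tau^-1 + s ^+ 2 / 2) * tail_sqr tau (Z w)))).
  apply: le_Rintegral => //; first exact: integrable_norm.
  by move=> w _; apply: dist_trunc_exp => //; rewrite sE.
rewrite RintegralD//; last 2 first.
- exact: integrable_scaler.
- by apply: integrable_scaler; exact: integrable_tail_sqr.
rewrite RintegralZl// RintegralZl//; last exact: integrable_tail_sqr.
rewrite EZ2.
have -> : tau^-1 ^+ 2 + `|s| * tau^-1 + s ^+ 2 / 2 = C / a ^+ 2.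
  rewrite /tau /s /C normrM normfV (gtr0_norm a0); field; lra.
have -> : zeta * s ^+ 2 * s2 = zeta * theta ^+ 2 * s2 / a ^+ 2.
  by rewrite /s; field; lra.
have -> : C / a ^+ 2 * \int[P]_w (tail_sqr tau (Z w)) =
   (C * \int[P]_w (tail_sqr tau (Z w))) / a ^+ 2 by rewrite mulrAC.
rewrite -mulrDl ler_wpM2r ?invr_ge0 ?sqr_ge0//.
move: q1; rewrite ler_pdivlMr// mulrC; lra.
Qed.

(** Centring removes the linear term, and [1 + y <= expR y] puts the bound in a form whose [n]-th
    power is explicit. *)
Lemma upper_trunc_mgf_le (s c K zeta : R) : 0 <= s -> s * c = zeta ->
  0 <= zeta <= 1 / 2 ->
  \int[P]_w (upper_trunc_exp s K (Z w)) <=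
    expR ((1 / 2 + zeta) * s ^+ 2 * s2 +
          expR (s * K) * fine (P [set w | c < Z w])).
Proof.
move=> s0 sc z01.
have mA : measurable [set w | c < Z w] by exact: measurable_gt_fun.
have iA : Lint (fun w => \1_[set w | c < Z w] w).
  apply: (@integrable_bounded_real _ 1) => [|w]; first exact: measurable_indic.
  by rewrite indicE; case: (_ \in _); rewrite ?normr1 ?normr0.
apply: le_trans (expR_ge1Dx _).
rewrite addrA -(integral_taylor s) -Rintegral_probability_indic//.
rewrite -RintegralZl// -RintegralD//; last exact: integrable_scaler.
apply: le_Rintegral => //.
- exact: integrable_upper_trunc_exp.
- by apply: integrable_addr => //; exact: integrable_scaler.
move=> w _; have := @upper_trunc_exp_le s c K zeta (Z w) s0 sc z01.
rewrite indicE; have [cz|cz] := ltP c (Z w); first by rewrite mem_set.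
by rewrite memNset//= => -[]; rewrite ltNge cz.
Qed.

End truncated_moments.

(** * Sums of independent variables *)

Section independent_sums.
Context {R : realType} {d : measure_display} {T : measurableType d}.
Variable P : probability T R.
Local Notation pr A := (fine (P A)).

Definition over (u y : R) : R := if u < y then 1 else 0.

Lemma over_ge0 u y : 0 <= over u y.
Proof. by rewrite /over; case: ifP. Qed.

Lemma measurable_over u : measurable_fun setT (over u).
Proof. by apply: measurable_fun_ifT => //; exact: measurable_fun_ltr. Qed.

Lemma integral_over (V : T -> R) u : measurable_fun setT V ->
  (\int[P]_w (over u (V w))%:E = (pr [set w | u < V w])%:E)%E.
Proof.
move=> mV.
have mA : measurable [set w | u < V w] by exact: measurable_gt_fun.
rewrite fineK ?fin_num_measure// -[X in P X]setIT -integral_indic//.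
apply: eq_integral => w _; rewrite indicE /over.
have [uw|uw] := ltP u (V w); first by rewrite mem_set.
by rewrite memNset//= => -[]; rewrite ltNge uw.
Qed.

Lemma Rintegral_over (V : T -> R) u : measurable_fun setT V ->
  \int[P]_w (over u (V w)) = pr [set w | u < V w].
Proof. by move=> mV; rewrite /Rintegral integral_over. Qed.

Variable Y : nat -> T -> R.
Hypothesis mY : forall i, measurable_fun setT (Y i).
Hypothesis indepY : forall (n : nat) (B : nat -> set R),
  (forall i, measurable (B i)) ->
  P (\bigcap_(i in `I_n) (Y i @^-1` B i)) = (\prod_(i < n) P (Y i @^-1` B i))%E.
Hypothesis eqdY : forall i B, measurable B -> P (Y i @^-1` B) = P (Y 0%N @^-1` B).

Local Notation Z := (Y 0%N).
Local Notation S n w := (\sum_(i < n) Y i w).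
Local Notation Lint f := (P.-integrable setT (EFin \o f)).

Let mS n : measurable_fun setT (fun w => S n w).
Proof. exact: measurable_sum. Qed.

Lemma integral_prod_iid (n : nat) (f : nat -> R -> R) :
  (forall i, measurable_fun setT (f i)) -> (forall i x, 0 <= f i x) ->
  (forall i, Lint (fun w => f i (Z w))) ->
  (\int[P]_w (\prod_(i < n) f i (Y i w))%:E =
   (\prod_(i < n) \int[P]_w (f i (Z w)))%:E)%E.
Proof.
move=> mf f0 If.
have E i : (\int[P]_w (f i (Y i w))%:E = (\int[P]_w (f i (Z w)))%:E)%E.
  rewrite (@ge0_integral_eq_distribution _ _ _ _ _ P Y mY i 0%N (f i))//.
    rewrite /Rintegral fineK//; exact: (integrable_fin_num measurableT (If i)).
  exact: eqdY.
rewrite (@integral_prod_indep _ _ _ _ _ P Y mY indepY)//.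
  by rewrite -prodEFin; apply: eq_bigr => i _; exact: E.
by move=> i; rewrite E.
Qed.

Let mprod n (f : nat -> R -> R) : (forall i, measurable_fun setT (f i)) ->
  measurable_fun setT (fun w => \prod_(i < n) f i (Y i w)).
Proof.
by move=> mf; apply: measurable_prod => i _; apply: measurableT_comp.
Qed.

Let prod_ge0 n (f : nat -> R -> R) w : (forall i x, 0 <= f i x) ->
  0 <= \prod_(i < n) f i (Y i w).
Proof. by move=> f0; apply: prodr_ge0. Qed.

Lemma prod_trunc_exp n s tau w :
  \prod_(i < n) trunc_exp s tau (Y i w) =
  if [forall i : 'I_n, `|Y i w| <= tau] then expR (s * S n w) else 0.
Proof.
case: ifPn => [/forallP h|/forallPn[i Yi]].
  rewrite mulr_sumr expR_sum; apply: eq_bigr => i _.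
  by rewrite /trunc_exp h.
by rewrite (bigD1 i)//= /trunc_exp (negbTE Yi) mul0r.
Qed.

Lemma prod_upper_trunc_exp n s K w : (forall i : 'I_n, Y i w <= K) ->
  \prod_(i < n) upper_trunc_exp s K (Y i w) = expR (s * S n w).
Proof.
move=> h; rewrite mulr_sumr expR_sum; apply: eq_bigr => i _.
by rewrite /upper_trunc_exp h.
Qed.

(** Integrate a pointwise bound: if the sum exceeds [y], either some summand exceeds [K] and is
    counted in the first term, or no factor is cut and the product is the full exponential. *)
Lemma truncated_chernoff n s K y : 0 <= s ->
  pr [set w | y < S n w] <= n%:R * pr [set w | K < Z w] +
    expR (- (s * y)) * (\int[P]_w (upper_trunc_exp s K (Z w))) ^+ n.
Proof.
move=> s0; rewrite -lee_fin -integral_over//.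
have mu := measurable_upper_trunc_exp s K.
have u0 x := upper_trunc_exp_ge0 s K x.
have iu := integrable_upper_trunc_exp P (mY 0) K s0.
apply: (@le_trans _ _ (\int[P]_w ((\sum_(i < n) (over K (Y i w))%:E) +
    (expR (- (s * y)))%:E * (\prod_(i < n) upper_trunc_exp s K (Y i w))%:E)%E)%E).
  apply: ge0_le_integral => //.
  - by move=> w _; rewrite lee_fin over_ge0.
  - apply/measurable_EFinP; exact: (measurableT_comp (measurable_over y)).
  - apply: emeasurable_funD.
      apply: emeasurable_sum => i; apply/measurable_EFinP.
      exact: (measurableT_comp (measurable_over K)).
    by apply: measurable_funeM; apply/measurable_EFinP; exact: (@mprod n (fun=> upper_trunc_exp s K)).
  move=> w _; rewrite sumEFin -EFinM -EFinD lee_fin {1}/over.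
  have s0' : 0 <= \sum_(i < n) over K (Y i w).
    by apply: sumr_ge0 => i _; exact: over_ge0.
  have p0 : 0 <= expR (- (s * y)) * \prod_(i < n) upper_trunc_exp s K (Y i w).
    by rewrite mulr_ge0 ?expR_ge0// (@prod_ge0 n (fun=> upper_trunc_exp s K)).
  case: ifP => [yS|_]; last by rewrite addr_ge0.
  have [h|/existsNP[i /negP]] := pselect (forall i : 'I_n, Y i w <= K).
    rewrite prod_upper_trunc_exp// -expRD; apply: le_trans (ler_wpDl s0' (lexx _)).
    by rewrite -expR0 ler_expR addrC subr_ge0 ler_wpM2l// ltW.
  rewrite -ltNge => Ki; apply: le_trans (ler_wpDr p0 (lexx _)).
  rewrite (bigD1 i)//= {1}/over Ki ler_wpDr// sumr_ge0// => j _.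
  exact: over_ge0.
rewrite ge0_integralD//; last 4 first.
- by move=> w _; apply: sume_ge0 => i _; rewrite lee_fin over_ge0.
- apply: emeasurable_sum => i; apply/measurable_EFinP.
  exact: (measurableT_comp (measurable_over K)).
- by move=> w _; rewrite -EFinM lee_fin mulr_ge0 ?expR_ge0// (@prod_ge0 n (fun=> upper_trunc_exp s K)).
- by apply: measurable_funeM; apply/measurable_EFinP; exact: (@mprod n (fun=> upper_trunc_exp s K)).
rewrite ge0_integral_sum//; last 2 first.
- by move=> i; apply/measurable_EFinP; exact: (measurableT_comp (measurable_over K)).
- by move=> i w _; rewrite lee_fin over_ge0.
rewrite ge0_integralZl ?lee_fin ?expR_ge0//; last 2 first.
- by apply/measurable_EFinP; exact: (@mprod n (fun=> upper_trunc_exp s K)).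
- by move=> w _; rewrite lee_fin (@prod_ge0 n (fun=> upper_trunc_exp s K)).
rewrite (@integral_prod_iid n (fun=> upper_trunc_exp s K))// prodr_const card_ord.
have E (i : 'I_n) : (\int[P]_w (over K (Y i w))%:E = (pr [set w | K < Z w])%:E)%E.
  rewrite (@ge0_integral_eq_distribution _ _ _ _ _ P Y mY i 0%N (over K))//.
  - exact: integral_over.
  - exact: eqdY.
  - exact: measurable_over.
  - exact: over_ge0.
rewrite (eq_bigr _ (fun i _ => E i)) sumEFin sumr_const card_ord.
by rewrite -EFinM -EFinD -[fine _ *+ n]mulr_natl lexx.
Qed.

(** On the truncation event let [W] be the sum. If [x < W <= v], then
    [expR (s * W) <= expR (s * v)]. If [W > v], raising the tilt by [s'] gains
    [expR (s' * (W - v))]; if [W <= x], lowering it by [s'] gains [expR (s' * (x - W))]. The three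
    terms on the right are these cases. *)
Lemma tilted_lower_bound n s s' tau x v : 0 <= s -> 0 <= s' ->
  (\int[P]_w (trunc_exp s tau (Z w))) ^+ n <=
    expR (s * v) * pr [set w | x < S n w] +
    expR (- (s' * v)) * (\int[P]_w (trunc_exp (s + s') tau (Z w))) ^+ n +
    expR (s' * x) * (\int[P]_w (trunc_exp (s - s') tau (Z w))) ^+ n.
Proof.
move=> s0 s'0.
have mt q := measurable_trunc_exp q tau.
have t0 q y := trunc_exp_ge0 q tau y.
have it q := integrable_trunc_exp P (mY 0) q tau.
have Eprod q : ((\int[P]_w (trunc_exp q tau (Z w))) ^+ n)%:E =
    (\int[P]_w (\prod_(i < n) trunc_exp q tau (Y i w))%:E)%E.
  by rewrite (@integral_prod_iid n (fun=> trunc_exp q tau))// prodr_const card_ord.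
have mp q : measurable_fun setT (fun w => (\prod_(i < n) trunc_exp q tau (Y i w))%:E).
  by apply/measurable_EFinP; exact: (@mprod n (fun=> trunc_exp q tau)).
have p0 q w : (0 <= (\prod_(i < n) trunc_exp q tau (Y i w))%:E)%E.
  by rewrite lee_fin (@prod_ge0 n (fun=> trunc_exp q tau)).
have mo : measurable_fun setT (fun w => (over x (S n w))%:E).
  by apply/measurable_EFinP; exact: (measurableT_comp (measurable_over x)).
have o0 w : (0 <= (over x (S n w))%:E)%E by rewrite lee_fin over_ge0.
have e0 y : (0 <= (expR y)%:E)%E by rewrite lee_fin expR_ge0.
rewrite -lee_fin !EFinD !EFinM !Eprod -integral_over//.
rewrite -!ge0_integralZl// -ge0_integralD//; last 4 first.
- by move=> w _; exact: mule_ge0.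
- exact: measurable_funeM.
- by move=> w _; exact: mule_ge0.
- exact: measurable_funeM.
rewrite -ge0_integralD//; last 4 first.
- by move=> w _; rewrite adde_ge0// mule_ge0.
- by apply: emeasurable_funD; exact: measurable_funeM.
- by move=> w _; exact: mule_ge0.
- exact: measurable_funeM.
apply: ge0_le_integral => //.
  apply: emeasurable_funD; last exact: measurable_funeM.
  by apply: emeasurable_funD; exact: measurable_funeM.
move=> w _; rewrite -!EFinM -!EFinD lee_fin !prod_trunc_exp.
case: ifP => _; last first.
  by rewrite !mulr0 !addr0 mulr_ge0 ?expR_ge0 ?over_ge0.
rewrite -!expRD; set W := S n w.
have ge0 y : 0 <= expR y := expR_ge0 y.
rewrite /over; have [xW|Wx] := ltP x W.
- rewrite mulr1; have [Wv|vW] := leP W v.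
    have : expR (s * W) <= expR (s * v) by rewrite ler_expR ler_wpM2l.
    by move=> h; rewrite -addrA ler_wpDr// addr_ge0.
  have h : expR (s * W) <= expR (- (s' * v) + (s + s') * W).
    rewrite ler_expR; have : 0 <= s' * (W - v) by rewrite mulr_ge0// subr_ge0 ltW.
    lra.
  by rewrite ler_wpDr// ler_wpDl.
- have h : expR (s * W) <= expR (s' * x + (s - s') * W).
    rewrite ler_expR; have : 0 <= s' * (x - W) by rewrite mulr_ge0// subr_ge0.
    lra.
  by rewrite mulr0 add0r ler_wpDl.
Qed.

(** Since [tau <= u], the events that summand [i] exceeds [u] and all others are at most [tau] in
    modulus are disjoint, so their indicators add up to at most 1. On one of them the sum exceeds
    [u - e] unless the other summands total less than [- e], an event controlled by the tilt
    [- s]. *)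
Lemma big_jump_lower_bound n s tau u e : 0 <= s -> tau <= u ->
  n%:R * (pr [set w | u < Z w] * (\int[P]_w (trunc_exp 0 tau (Z w))) ^+ n.-1) <=
  pr [set w | u - e < S n w] +
  n%:R * (expR (- (s * e)) * (pr [set w | u < Z w] *
    (\int[P]_w (trunc_exp (- s) tau (Z w))) ^+ n.-1)).
Proof.
move=> s0 tauu.
pose F (i : nat) q j y := if j == i then over u y else trunc_exp q tau y.
have mF i q j : measurable_fun setT (F i q j).
  rewrite /F; case: (j == i); [exact: measurable_over|exact: measurable_trunc_exp].
have F0 i q j y : 0 <= F i q j y.
  by rewrite /F; case: (j == i); rewrite ?over_ge0 ?trunc_exp_ge0.
have IF i q j : Lint (fun w => F i q j (Z w)).
  rewrite /F; case: (j == i); last exact: integrable_trunc_exp.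
  apply: (@integrable_bounded_real _ _ _ _ _ 1).
    exact: (measurableT_comp (measurable_over u)).
  by move=> w; rewrite /over; case: ifP; rewrite ?normr1 ?normr0.
have Eprod (i : 'I_n) q :
    (\int[P]_w (\prod_(j < n) F i q j (Y j w))%:E)%E =
    (pr [set w | u < Z w] * (\int[P]_w (trunc_exp q tau (Z w))) ^+ n.-1)%:E.
  rewrite (@integral_prod_iid n (F i q))// (bigD1 i)//= /F eqxx Rintegral_over//.
  congr (_ * _)%:E.
  under eq_bigr => j ji do rewrite (negbTE (ji : (j : nat) != i)).
  rewrite prodr_const; congr (_ ^+ _).
  by rewrite -[in RHS](card_ord n) -(cardC1 i).
have mp i q : measurable_fun setT (fun w => (\prod_(j < n) F i q j (Y j w))%:E).
  by apply/measurable_EFinP; exact: (@mprod n (F i q)).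
have p0 i q w : 0 <= \prod_(j < n) F i q j (Y j w) by exact: (@prod_ge0 n (F i q)).
have pe0 i q w : (0 <= (\prod_(j < n) F i q j (Y j w))%:E)%E by rewrite lee_fin.
have mo : measurable_fun setT (fun w => (over (u - e) (S n w))%:E).
  by apply/measurable_EFinP; exact: (measurableT_comp (measurable_over (u - e))).
have o0 w : (0 <= (over (u - e) (S n w))%:E)%E by rewrite lee_fin over_ge0.
have E1 q : (\int[P]_w (\sum_(i < n) (\prod_(j < n) F i q j (Y j w))%:E)%E)%E =
   (n%:R * (pr [set w | u < Z w] * (\int[P]_w (trunc_exp q tau (Z w))) ^+ n.-1))%:E.
  rewrite ge0_integral_sum//.
  rewrite (eq_bigr _ (fun i _ => Eprod i q)) sumEFin sumr_const card_ord.
  by rewrite [in RHS]mulr_natl.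
have e0 : (0 <= (expR (- (s * e)))%:E)%E by rewrite lee_fin expR_ge0.
rewrite -lee_fin EFinD -E1 -integral_over//.
rewrite [in leRHS]mulrCA EFinM -E1.
have ms q : measurable_fun setT
    (fun w => (\sum_(i < n) (\prod_(j < n) F i q j (Y j w))%:E)%E).
  by apply: emeasurable_sum.
have se0 q w : (0 <= \sum_(i < n) (\prod_(j < n) F i q j (Y j w))%:E)%E.
  exact: sume_ge0.
rewrite -ge0_integralZl// -ge0_integralD//; last 2 first.
- by move=> w _; exact: mule_ge0.
- exact: measurable_funeM.
apply: ge0_le_integral => //.
  by apply: emeasurable_funD => //; exact: measurable_funeM.
move=> w _; rewrite !sumEFin -EFinM -EFinD lee_fin.
have FE (i : 'I_n) q : \prod_(j < n) F i q j (Y j w) =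
    if (u < Y i w) && [forall j : 'I_n, (j != i) ==> (`|Y j w| <= tau)]
    then expR (q * (S n w - Y i w)) else 0.
  rewrite (bigD1 i)//= {1}/F eqxx /over.
  have [uY|_] /= := ltP u (Y i w); last by rewrite mul0r.
  have -> : S n w - Y i w = \sum_(j < n | j != i) Y j w.
    by rewrite [X in X - _](bigD1 i)//= addrAC subrr add0r.
  rewrite mul1r.
  case: ifPn => [/forallP h|/forallPn[j]].
    rewrite mulr_sumr expR_sum; apply: eq_bigr => j ji.
    rewrite /F (negbTE (ji : (j : nat) != i)) /trunc_exp.
    by have := h j; rewrite ji /= => ->.
  rewrite negb_imply => /andP[ji Yj]; rewrite (bigD1 j)//=.
  by rewrite /F (negbTE (ji : (j : nat) != i)) /trunc_exp (negbTE Yj) mul0r.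
have r0 : 0 <= over (u - e) (S n w) + expR (- (s * e)) *
    \sum_(i < n) \prod_(j < n) F i (- s) j (Y j w).
  by rewrite addr_ge0 ?over_ge0// mulr_ge0 ?expR_ge0// sumr_ge0.
have [/existsP[i /andP[uY /forallP h]]|/existsPn h] := boolP
    [exists i : 'I_n, (u < Y i w) && [forall j : 'I_n, (j != i) ==> (`|Y j w| <= tau)]];
  last first.
  by rewrite big1// => i _; rewrite FE (negbTE (h i)).
have hi : (u < Y i w) && [forall j : 'I_n, (j != i) ==> (`|Y j w| <= tau)].
  by rewrite uY; apply/forallP.
(* With [q = 0] the products are indicators, and a second jump at [j] would force
   [Y i w <= tau <= u]. *)
have -> : \sum_(i < n) \prod_(j < n) F i 0 j (Y j w) = 1.
  rewrite (bigD1 i)//= FE hi mul0r expR0 big1 ?addr0// => j ji.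
  rewrite FE; case: ifP => // /andP[_ /forallP/(_ i)].
  rewrite eq_sym ji /= => Yi; have := le_lt_trans (le_trans (ler_norm _) Yi).
  by move=> /(_ _ (le_lt_trans tauu uY)); rewrite ltxx.
rewrite {1}/over; have [_|Wu] := ltP (u - e) (S n w).
  by rewrite ler_wpDr// mulr_ge0 ?expR_ge0// sumr_ge0.
rewrite add0r (bigD1 i)//= FE hi mulrDr -expRD ler_wpDr//.
  by rewrite mulr_ge0 ?expR_ge0// sumr_ge0.
(* Here the sum is at most [u - e] although [Y i w] exceeds [u], so the remaining summands lie below
   [- e]. *)
rewrite -expR0 ler_expR.
have : 0 <= s * (Y i w - S n w - e) by rewrite mulr_ge0//; lra.
lra.
Qed.

End independent_sums.

(** * Three estimates separating probability from asymptotics *)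

Section estimates.
Context {R : realType}.
Implicit Types (G : nat -> R) (H : R -> R) (D : R -> nat -> R).

Definition scale_lo G (n : nat) : R := Num.sqrt (n%:R / G n).
Definition scale_hi G (n : nat) : R := Num.sqrt (n%:R * G n).

(** [H] is a tail and [D x n] a deviation probability, left abstract so that both may also be sums
    of two. The constant [c] depends on [x] and [eps] alone; [kappa] measures the truncation level
    in the Chernoff bound. *)
Definition upper_estimate (s2 : R) G H D := forall x eps : R, 0 < x -> 0 < eps ->
  exists2 c : R, 0 < c & forall kappa : R, 0 < kappa -> \forall n \near \oo,
    D x n <= n%:R * H (c * scale_lo G n) +
      expR (- (x ^+ 2 / (2 * s2) - eps) * G n +
            n%:R * (expR (kappa * G n) * H (c * scale_lo G n))).

Definition gauss_estimate (s2 : R) G D := forall x eps : R, 0 < x -> 0 < eps ->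
  \forall n \near \oo, expR (- (x ^+ 2 / (2 * s2) + eps) * G n) <= D x n.

(** The level is at scale [scale_hi], whereas [upper_estimate] uses [scale_lo]; their ratio [G n] is
    invisible to [g] after taking logarithms. *)
Definition jump_estimate G H D := forall x : R, 0 < x ->
  exists2 u : R, 0 < u & forall eps : R, 0 < eps -> \forall n \near \oo,
    n%:R * H (u * scale_hi G n) * expR (- eps * G n) <= D x n.

Lemma scale_lo_sqr G n : 0 < G n -> scale_lo G n ^+ 2 = n%:R / G n.
Proof. by move=> G0; rewrite /scale_lo sqr_sqrtr// divr_ge0// ltW. Qed.

Lemma scale_hiE G n : 0 < G n -> scale_hi G n = scale_lo G n * G n.
Proof.
move=> G0; rewrite /scale_hi /scale_lo.
rewrite (_ : n%:R * G n = n%:R / G n * G n ^+ 2); last by field; rewrite gt_eqF.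
have h : 0 <= n%:R / G n by rewrite divr_ge0// ltW.
by rewrite (sqrtrM _ h) sqrtr_sqr gtr0_norm.
Qed.

End estimates.

(** * The three estimates for centred summands *)

Section moderate_deviations.
Context {R : realType} {d : measure_display} {T : measurableType d}.
Variable P : probability T R.
Local Notation pr A := (fine (P A)).
Variable Y : nat -> T -> R.
Hypothesis mY : forall i, measurable_fun setT (Y i).
Hypothesis indepY : forall (n : nat) (B : nat -> set R),
  (forall i, measurable (B i)) ->
  P (\bigcap_(i in `I_n) (Y i @^-1` B i)) = (\prod_(i < n) P (Y i @^-1` B i))%E.
Hypothesis eqdY : forall i B, measurable B -> P (Y i @^-1` B) = P (Y 0%N @^-1` B).
Variables (s2 : R).
Hypotheses (s20 : 0 < s2) (iZ : P.-integrable setT (EFin \o Y 0%N))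
  (iZ2 : P.-integrable setT (EFin \o (fun w => Y 0%N w ^+ 2))).
Hypotheses (EZ : \int[P]_w (Y 0%N w) = 0) (EZ2 : \int[P]_w (Y 0%N w ^+ 2) = s2).
Variable G : nat -> R.
Hypotheses (Gy : G n @[n --> \oo] --> +oo) (ay : scale_lo G n @[n --> \oo] --> +oo).

Local Notation Z := (Y 0%N).
Local Notation a := (scale_lo G).
Local Notation b := (scale_hi G).
Local Notation H t := (pr [set w | t < Z w]).
Local Notation D x n := (pr [set w | x * b n < \sum_(i < n) Y i w]).
Local Notation M q eta n := (\int[P]_w (trunc_exp (q / a n) (eta * a n) (Z w))).

Let G_ge A : \forall n \near \oo, A <= G n.
Proof. by move/cvgryPge : Gy; exact. Qed.

Let a_ge A : \forall n \near \oo, A <= a n.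
Proof. by move/cvgryPge : ay; exact. Qed.

Let eq_ler (y z : R) : y = z -> y <= z.
Proof. by move=> ->. Qed.

Let H_ge0 t : 0 <= H t.
Proof. by rewrite fine_ge0. Qed.

Let H_nincr t t' : t <= t' -> H t' <= H t.
Proof.
move=> tt'; apply: le_fine_probability; [exact: measurable_gt_fun..|].
by move=> w /=; exact: le_lt_trans.
Qed.

Lemma iid_upper_estimate : upper_estimate s2 G (fun t => H t) (fun x n => D x n).
Proof.
move=> x eps x0 eps0.
(* The minimiser of [theta ^ 2 * s2 / 2 - theta * x], with minimum [- x ^ 2 / (2 * s2)]. *)
pose theta := x / s2; have th0 : 0 < theta by rewrite divr_gt0.
pose zeta := Num.min (1 / 2) (eps * s2 / x ^+ 2).
have x20 : 0 < x ^+ 2 by rewrite exprn_gt0.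
have z0 : 0 < zeta by rewrite lt_min !divr_gt0 ?mulr_gt0.
have z1 : zeta <= 1 / 2 by rewrite ge_min lexx.
have z2 : zeta * (x ^+ 2 / s2) <= eps.
  by rewrite mulrA ler_pdivrMr// -ler_pdivlMr// ge_min lexx orbT.
exists (zeta / theta); first by rewrite divr_gt0.
move=> kappa kappa0; near=> n.
have G0 : 0 < G n.
  by apply: (@lt_le_trans _ _ 1) => //; near: n; exact: G_ge.
have a0 : 0 < a n.
  by apply: (@lt_le_trans _ _ 1) => //; near: n; exact: a_ge.
have n0 : 0 < n%:R :> R.
  by rewrite ltr0n; near: n; exact: nbhs_infty_gt.
have aE : n%:R = a n ^+ 2 * G n by rewrite scale_lo_sqr// divfK// gt_eqF.
(* [K] is chosen to make [s * K = kappa * G n]; being of order [b n], it eventually exceeds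
   [c * a n], so one tail serves both terms. *)
pose s := theta / a n; pose K := kappa / theta * b n.
have s0 : 0 <= s by rewrite divr_ge0 ?ltW.
have sK : s * K = kappa * G n.
  by rewrite /s /K scale_hiE//; field; rewrite !gt_eqF.
have cK : zeta / theta * a n <= K.
  rewrite /K scale_hiE// (_ : _ * (_ * _) = kappa * G n / theta * a n); last first.
    by field; rewrite gt_eqF.
  rewrite ler_pM2r// ler_pM2r ?invr_gt0//.
  have : zeta / kappa <= G n by near: n; exact: G_ge.
  by rewrite ler_pdivrMr// mulrC.
have := @truncated_chernoff _ _ _ P Y mY indepY eqdY n s K (x * b n) s0.
move=> /le_trans; apply; apply: lerD.
  by rewrite ler_wpM2l// H_nincr.
have m0 : 0 <= \int[P]_w (upper_trunc_exp s K (Z w)).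
  by apply: Rintegral_ge0 => w _; exact: upper_trunc_exp_ge0.
have sc : s * (zeta / theta * a n) = zeta by rewrite /s; field; rewrite !gt_eqF.
have zz : 0 <= zeta <= 1 / 2 by rewrite (ltW z0).
have := @upper_trunc_mgf_le _ _ _ P Z s2 (mY 0) iZ iZ2 EZ EZ2 s _ K zeta s0 sc zz.
rewrite sK => hm.
have := lerXn2r n m0 (expR_ge0 _) hm; rewrite -expRM_natl => hn.
apply: le_trans (ler_wpM2l (expR_ge0 _) hn) _.
rewrite -expRD ler_expR mulrDr addrA lerD2r.
have -> : s * (x * b n) = x ^+ 2 / s2 * G n.
  by rewrite scale_hiE// /s /theta; field; rewrite !gt_eqF.
have -> : n%:R * ((1 / 2 + zeta) * s ^+ 2 * s2) = (1 / 2 + zeta) * (x ^+ 2 / s2) * G n.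
  by rewrite aE /s /theta; field; rewrite !gt_eqF.
have -> : x ^+ 2 / (2 * s2) = x ^+ 2 / s2 / 2 by field; rewrite gt_eqF.
have : zeta * (x ^+ 2 / s2) * G n <= eps * G n by rewrite ler_pM2r.
lra.
Unshelve. all: by end_near. Qed.

(** The Gaussian asymptotics of [trunc_mgf] in multiplicative form, ready for [n]-th powers. Half of
    [eps] pays for the moment, the other half for passing to the exponential. *)
Let trunc_mgf_expR (psi eps : R) : 0 < eps -> exists2 eta0 : R, 0 < eta0 &
  forall eta, 0 < eta <= eta0 -> \forall n \near \oo,
    expR ((psi ^+ 2 * s2 / 2 - eps) / a n ^+ 2) <= M psi eta n <=
    expR ((psi ^+ 2 * s2 / 2 + eps) / a n ^+ 2).
Proof.
move=> eps0; have e2 : 0 < eps / 2 by rewrite divr_gt0.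
have [eta0 eta00 Heta] := @trunc_mgf _ _ _ P Z s2 (mY 0) iZ iZ2 EZ EZ2 psi _ e2.
exists eta0 => // eta etah; have [a0 a00 Ha] := Heta _ etah.
pose A := psi ^+ 2 * s2 / 2 - eps / 2.
near=> n.
have an0 : 0 < a n.
  by apply: (@lt_le_trans _ _ 1) => //; near: n; exact: a_ge.
have an2 : 0 < a n ^+ 2 by rewrite exprn_gt0.
have := Ha (a n); rewrite ler_distl => /(_ _)/andP.
have -> : a0 <= a n by near: n; exact: a_ge.
move=> /(_ isT)[h1 h2]; apply/andP; split; last first.
  apply: le_trans h2 _; apply: le_trans (expR_ge1Dx _).
  rewrite -addrA lerD2l -mulrDl ler_wpM2r ?invr_ge0 ?ltW//; lra.
apply: le_trans h1.
have -> : 1 + psi ^+ 2 * s2 / 2 / a n ^+ 2 - eps / 2 / a n ^+ 2 = 1 + A / a n ^+ 2.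
  by rewrite /A; field; rewrite gt_eqF.
have -> : (psi ^+ 2 * s2 / 2 - eps) / a n ^+ 2 = A / a n ^+ 2 - eps / 2 / a n ^+ 2.
  by rewrite /A; field; rewrite gt_eqF.
(* The term with [2 * |A|] gives [A / a ^ 2 >= - 1 / 2]; the one with [4 * A ^ 2 / eps] gives
   [2 * (A / a ^ 2) ^ 2 <= eps / 2 / a ^ 2], as [expR_subr_le1Dx] requires. *)
have big : 1 + 2 * `|A| + 4 * A ^+ 2 / eps <= a n ^+ 2.
  apply: (@le_trans _ _ (a n)).
    by near: n; exact: a_ge.
  have a1 : 1 <= a n by near: n; exact: a_ge.
  by rewrite expr2 ler_peMr// (le_trans ler01).
have A20 : 0 <= A ^+ 2 := sqr_ge0 _.
have A0 : 0 <= `|A| := normr_ge0 _.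
have Ae0 : 0 <= 4 * A ^+ 2 / eps by rewrite divr_ge0 ?(ltW eps0)// mulr_ge0.
have lA : - `|A| <= A by rewrite lerNl -normrN ler_norm.
apply: expR_subr_le1Dx.
  rewrite ler_pdivlMr//; lra.
rewrite exprMn exprVn [leRHS](_ : _ = (eps / 2 * a n ^+ 2) / (a n ^+ 2) ^+ 2); last first.
  by field; rewrite gt_eqF.
rewrite mulrA ler_wpM2r ?invr_ge0 ?sqr_ge0//.
have : 4 * A ^+ 2 / eps <= a n ^+ 2 by lra.
rewrite ler_pdivrMr//; lra.
Unshelve. all: by end_near. Qed.

Let expR_near (k : R) : 0 < k -> \forall n \near \oo, expR (- (k * G n)) <= 1 / 4.
Proof.
move=> k0; near=> n.
rewrite expRN div1r lef_pV2 ?posrE ?expR_gt0//.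
apply: le_trans (expR_ge1Dx _).
have : 3 / k <= G n by near: n; exact: G_ge.
by rewrite ler_pdivrMr// mulrC; lra.
Unshelve. all: by end_near. Qed.

Lemma iid_gauss_estimate : gauss_estimate s2 G (fun x n => D x n).
Proof.
move=> x eps x0 eps0.
(* Half the width of the window, in units of [b n]. It is such that the excess
   [(4 * x * e + 13 / 4 * e ^ 2) / (2 * s2)] of the final exponent is at most [eps / 2]. *)
pose e := Num.min 1 (eps * s2 / (4 * (x + 1))).
have x1 : 0 < 4 * (x + 1) by lra.
have e0 : 0 < e by rewrite lt_min ltr01 divr_gt0// mulr_gt0.
have e1 : e <= 1 by rewrite ge_min lexx.
have e2 : e * (4 * (x + 1)) <= eps * s2.
  by rewrite -ler_pdivlMr// ge_min lexx orbT.
(* Leaving the window on either side changes the exponent by [- e ^ 2 / (2 * s2)]. The two moment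
   errors give back [2 * eps'], half of it, so a net gain [k] remains. *)
pose eps' := e ^+ 2 / (8 * s2).
have eps'0 : 0 < eps' by rewrite divr_gt0 ?exprn_gt0// mulr_gt0.
pose k := e ^+ 2 / (4 * s2).
have k0 : 0 < k by rewrite divr_gt0 ?exprn_gt0// mulr_gt0.
(* The tilt [theta] centres the sum at [(x + e) * b n], the midpoint of the window from [x * b n] to
   [v * b n]; [theta'] moves the centre to one of its ends. *)
pose v := x + 2 * e; pose theta := (x + e) / s2; pose theta' := e / s2.
have th0 : 0 < theta by rewrite divr_gt0// addr_gt0.
have th'0 : 0 < theta' by rewrite divr_gt0.
have [eta1 eta10 H1] := @trunc_mgf_expR theta _ eps'0.
have [eta2 eta20 H2] := @trunc_mgf_expR (theta + theta') _ eps'0.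
have [eta3 eta30 H3] := @trunc_mgf_expR (theta - theta') _ eps'0.
pose eta := Num.min eta1 (Num.min eta2 eta3).
have eta0 : 0 < eta by rewrite !lt_min eta10 eta20.
have {}H1 := H1 eta; have {}H2 := H2 eta; have {}H3 := H3 eta.
have le1 : 0 < eta <= eta1 by rewrite eta0 ge_min lexx.
have le2 : 0 < eta <= eta2 by rewrite eta0 !ge_min lexx orbT.
have le3 : 0 < eta <= eta3 by rewrite eta0 !ge_min lexx !orbT.
near=> n.
have G0 : 0 < G n.
  by apply: (@lt_le_trans _ _ 1) => //; near: n; exact: G_ge.
have a0 : 0 < a n.
  by apply: (@lt_le_trans _ _ 1) => //; near: n; exact: a_ge.
have n0 : 0 < n%:R :> R.
  by rewrite ltr0n; near: n; exact: nbhs_infty_gt.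
have aE : n%:R = a n ^+ 2 * G n by rewrite scale_lo_sqr// divfK// gt_eqF.
have na r : n%:R * (r / a n ^+ 2) = r * G n by rewrite aE; field; rewrite gt_eqF.
have /andP[h1 _] : expR ((theta ^+ 2 * s2 / 2 - eps') / a n ^+ 2) <= M theta eta n <=
    expR ((theta ^+ 2 * s2 / 2 + eps') / a n ^+ 2) by near: n; exact: H1.
have /andP[_ h2] : expR (((theta + theta') ^+ 2 * s2 / 2 - eps') / a n ^+ 2) <=
    M (theta + theta') eta n <=
    expR (((theta + theta') ^+ 2 * s2 / 2 + eps') / a n ^+ 2) by near: n; exact: H2.
have /andP[_ h3] : expR (((theta - theta') ^+ 2 * s2 / 2 - eps') / a n ^+ 2) <=
    M (theta - theta') eta n <=
    expR (((theta - theta') ^+ 2 * s2 / 2 + eps') / a n ^+ 2) by near: n; exact: H3.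
have M0 q : 0 <= M q eta n by apply: Rintegral_ge0 => w _; exact: trunc_exp_ge0.
have {}h1 : expR ((theta ^+ 2 * s2 / 2 - eps') * G n) <= M theta eta n ^+ n.
  by rewrite -na expRM_natl lerXn2r ?nnegrE ?expR_ge0.
have {}h2 : M (theta + theta') eta n ^+ n <=
    expR (((theta + theta') ^+ 2 * s2 / 2 + eps') * G n).
  by rewrite -na expRM_natl lerXn2r ?nnegrE ?expR_ge0.
have {}h3 : M (theta - theta') eta n ^+ n <=
    expR (((theta - theta') ^+ 2 * s2 / 2 + eps') * G n).
  by rewrite -na expRM_natl lerXn2r ?nnegrE ?expR_ge0.
have s0 : 0 <= theta / a n by rewrite divr_ge0 ?ltW.
have s'0 : 0 <= theta' / a n by rewrite divr_ge0 ?ltW.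
have := @tilted_lower_bound _ _ _ P Y mY indepY eqdY n _ _ (eta * a n)
  (x * b n) (v * b n) s0 s'0.
rewrite -mulrDl -mulrBl => h.
have sb q y : q / a n * (y * b n) = q * y * G n.
  by rewrite scale_hiE//; field; rewrite gt_eqF.
rewrite !sb in h.
pose E := expR ((theta ^+ 2 * s2 / 2 - eps') * G n).
have hk : expR (- (k * G n)) <= 1 / 4 by near: n; exact: expR_near.
have E0 : 0 < E := expR_gt0 _.
have {}h2 : expR (- (theta' * v * G n)) * M (theta + theta') eta n ^+ n <= 1 / 4 * E.
  apply: le_trans (ler_wpM2l (expR_ge0 _) h2) _.
  apply: (@le_trans _ _ (expR (- (k * G n)) * E)); last by rewrite ler_pM2r.
  rewrite /E -!expRD ler_expR /k /eps' /theta' /theta /v.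
  apply: eq_ler; field; rewrite gt_eqF//.
have {}h3 : expR (theta' * x * G n) * M (theta - theta') eta n ^+ n <= 1 / 4 * E.
  apply: le_trans (ler_wpM2l (expR_ge0 _) h3) _.
  apply: (@le_trans _ _ (expR (- (k * G n)) * E)); last by rewrite ler_pM2r.
  rewrite /E -!expRD ler_expR /k /eps' /theta' /theta /v.
  apply: eq_ler; field; rewrite gt_eqF//.
have {}h : 1 / 2 * E <= expR (theta * v * G n) * D x n.
  by move: h h1; rewrite -/E => h h1; clear -h h1 h2 h3; lra.
have hq : expR (- (eps / 2 * G n)) <= 1 / 4 by near: n; apply: expR_near; lra.
have {h} : expR (- (theta * v * G n)) * (1 / 2 * E) <= D x n.
  by rewrite expRN ler_pdivrMl ?expR_gt0.
apply: le_trans.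
rewrite mulrCA -expRD.
have : expR (- (x ^+ 2 / (2 * s2) + eps) * G n) <=
   expR (- (eps / 2 * G n)) * expR (- (theta * v * G n) + (theta ^+ 2 * s2 / 2 - eps') * G n).
  rewrite -expRD ler_expR.
  have -> : - (theta * v * G n) + (theta ^+ 2 * s2 / 2 - eps') * G n =
     - ((x ^+ 2 + 4 * x * e + 13 / 4 * e ^+ 2) / (2 * s2)) * G n.
    by rewrite /theta /v /eps'; field; rewrite gt_eqF.
  have -> : - (eps / 2 * G n) + - ((x ^+ 2 + 4 * x * e + 13 / 4 * e ^+ 2) / (2 * s2)) * G n
    = - (eps / 2 + (x ^+ 2 + 4 * x * e + 13 / 4 * e ^+ 2) / (2 * s2)) * G n by ring.
  rewrite ler_pM2r// lerN2 (mulrDl _ _ (2 * s2)^-1) (mulrDl _ _ (2 * s2)^-1).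
  have : (4 * x * e + 13 / 4 * e ^+ 2) / (2 * s2) <= eps / 2.
    rewrite ler_pdivrMr ?mulr_gt0//.
    have : e ^+ 2 <= e by rewrite expr2 ler_piMl// ltW.
    move=> ee; clear h1 h2 h3; lra.
  rewrite mulrDl => hh; clear h1 h2 h3; lra.
move=> /le_trans; apply; rewrite ler_pM2r ?expR_gt0//; clear h1 h2 h3; lra.
Unshelve. all: by end_near. Qed.

Lemma iid_jump_estimate : jump_estimate G (fun t => H t) (fun x n => D x n).
Proof.
(* A jump over [2 * x * b n] leaves a margin [x * b n] for the other summands. *)
move=> x x0; exists (2 * x); first by rewrite mulr_gt0.
move=> eps eps0.
pose theta := x / s2; have th0 : 0 < theta by rewrite divr_gt0.
have x20 : 0 < x ^+ 2 by rewrite exprn_gt0.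
pose k := x ^+ 2 / s2 / 4.
have k0 : 0 < k by rewrite !divr_gt0.
(* The bad event has exponent [- x ^ 2 / (2 * s2)]. The second bound makes [2 * eps'] at most half
   of that, leaving [k]; the first one keeps the loss within the allowed [eps]. *)
pose eps' := Num.min (eps / 2) (x ^+ 2 / (8 * s2)).
have eps'0 : 0 < eps' by rewrite lt_min !divr_gt0// mulr_gt0.
have e1 : eps' <= eps / 2 by rewrite ge_min lexx.
have e2 : eps' <= x ^+ 2 / s2 / 8.
  by rewrite ge_min; apply/orP; right; apply: eq_ler; field; rewrite gt_eqF.
have [eta1 eta10 H1] := @trunc_mgf_expR 0 _ eps'0.
have [eta2 eta20 H2] := @trunc_mgf_expR (- theta) _ eps'0.
pose eta := Num.min eta1 eta2.
have eta0 : 0 < eta by rewrite !lt_min eta10 eta20.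
have {}H1 := H1 eta; have {}H2 := H2 eta.
have le1 : 0 < eta <= eta1 by rewrite eta0 ge_min lexx.
have le2 : 0 < eta <= eta2 by rewrite eta0 !ge_min lexx orbT.
near=> n.
have G0 : 0 < G n.
  by apply: (@lt_le_trans _ _ 1) => //; near: n; exact: G_ge.
have a0 : 0 < a n.
  by apply: (@lt_le_trans _ _ 1) => //; near: n; exact: a_ge.
have n0 : (0 < n)%N by near: n; exact: nbhs_infty_gt.
have n0R : 0 < n%:R :> R by rewrite ltr0n.
have aE : n%:R = a n ^+ 2 * G n by rewrite scale_lo_sqr// divfK// gt_eqF.
(* Only [n.-1] factors are left beside the jump, so [n / a ^ 2 = G] is used as an inequality, valid
   for a nonnegative rate. *)
have na r : 0 <= r -> n.-1%:R * (r / a n ^+ 2) <= r * G n.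
  move=> r0; apply: (@le_trans _ _ (n%:R * (r / a n ^+ 2))).
    by rewrite ler_wpM2r ?divr_ge0 ?sqr_ge0// ler_nat leq_pred.
  by rewrite aE; apply: eq_ler; field; rewrite gt_eqF.
have /andP[h1 _] : expR ((0 ^+ 2 * s2 / 2 - eps') / a n ^+ 2) <= M 0 eta n <=
    expR ((0 ^+ 2 * s2 / 2 + eps') / a n ^+ 2) by near: n; exact: H1.
have /andP[_ h2] : expR (((- theta) ^+ 2 * s2 / 2 - eps') / a n ^+ 2) <=
    M (- theta) eta n <=
    expR (((- theta) ^+ 2 * s2 / 2 + eps') / a n ^+ 2) by near: n; exact: H2.
have M0 q : 0 <= M q eta n by apply: Rintegral_ge0 => w _; exact: trunc_exp_ge0.
have {}h1 : expR (- eps' * G n) <= M 0 eta n ^+ n.-1.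
  apply: (@le_trans _ _ (expR ((0 ^+ 2 * s2 / 2 - eps') / a n ^+ 2) ^+ n.-1)).
    rewrite -expRM_natl ler_expR expr0n/= !mul0r sub0r !mulNr mulrN lerN2.
    exact: na (ltW eps'0).
  by rewrite lerXn2r ?nnegrE ?expR_ge0.
have {}h2 : M (- theta) eta n ^+ n.-1 <= expR ((x ^+ 2 / s2 / 2 + eps') * G n).
  apply: (@le_trans _ _ (expR (((- theta) ^+ 2 * s2 / 2 + eps') / a n ^+ 2) ^+ n.-1)).
    by rewrite lerXn2r ?nnegrE ?expR_ge0.
  rewrite -expRM_natl ler_expR.
  have -> : (- theta) ^+ 2 * s2 / 2 = x ^+ 2 / s2 / 2.
    by rewrite /theta; field; rewrite gt_eqF.
  by apply: na; rewrite addr_ge0 ?(ltW eps'0)// !divr_ge0 ?ltW.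
have s0 : 0 <= theta / a n by rewrite divr_ge0 ?ltW.
have tu : eta * a n <= 2 * x * b n.
  rewrite scale_hiE// mulrCA [eta * _]mulrC ler_pM2l// -ler_pdivrMl ?mulr_gt0//.
  by near: n; exact: G_ge.
have := @big_jump_lower_bound _ _ _ P Y mY indepY eqdY n _ (eta * a n)
  (2 * x * b n) (x * b n) s0 tu.
have -> : 2 * x * b n - x * b n = x * b n by ring.
have -> : theta / a n * (x * b n) = x ^+ 2 / s2 * G n.
  by rewrite scale_hiE// /theta; field; rewrite !gt_eqF.
rewrite -[- (theta / a n)]mulNr -{1}(mul0r (a n)^-1) => h.
set p := H (2 * x * b n) in h *; have p0 : 0 <= n%:R * p by rewrite mulr_ge0// H_ge0.
set E := expR (- eps' * G n) in h1.
have E0 : 0 < E := expR_gt0 _.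
have hk : expR (- (k * G n)) <= 1 / 4 by near: n; exact: expR_near.
have hq : expR (- (eps / 2 * G n)) <= 1 / 4 by near: n; apply: expR_near; lra.
have {}h2 : expR (- (x ^+ 2 / s2 * G n)) * M (- theta) eta n ^+ n.-1 <= 1 / 4 * E.
  apply: le_trans (ler_wpM2l (expR_ge0 _) h2) _.
  apply: (@le_trans _ _ (expR (- (k * G n)) * E)); last by rewrite ler_pM2r.
  rewrite /E -!expRD ler_expR /k.
  have : eps' * G n <= x ^+ 2 / s2 / 8 * G n by rewrite ler_pM2r.
  move=> hh; clear h h1; lra.
have {}h : n%:R * p * (3 / 4 * E) <= D x n.
  have g1 : n%:R * p * E <= n%:R * (p * M 0 eta n ^+ n.-1).
    by rewrite mulrA ler_wpM2l.
  have g2 : n%:R * (expR (- (x ^+ 2 / s2 * G n)) * (p * M (- theta) eta n ^+ n.-1)) <=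
      n%:R * p * (1 / 4 * E).
    apply: (@le_trans _ _ (n%:R * p * (expR (- (x ^+ 2 / s2 * G n)) *
      M (- theta) eta n ^+ n.-1))); last by rewrite ler_wpM2l.
    by apply: eq_ler; ring.
  lra.
apply: le_trans h; rewrite ler_wpM2l//.
apply: (@le_trans _ _ (expR (- (eps / 2 * G n)) * E)); last first.
  by rewrite ler_pM2r//; clear h1 h2; lra.
rewrite /E -expRD ler_expR.
have : eps' * G n <= eps / 2 * G n by rewrite ler_pM2r.
move=> hh; clear h1 h2; lra.
Unshelve. all: by end_near. Qed.

End moderate_deviations.

(** * Regular variation *)

Section regular_variation.
Context {R : realType}.
Variables (rho : R) (g : R -> R).
Hypothesis rv : regvar_class rho g.

Local Notation G := (fun n : nat => g (ln n%:R)).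
Local Notation a := (scale_lo G).
Local Notation b := (scale_hi G).

Lemma regvar_nd s t : 0 <= s -> s <= t -> g s <= g t.
Proof. by case: rv => h _ _ _; exact: h. Qed.

Lemma regvar_ge (A : R) : \forall t \near +oo, A <= g t.
Proof. by case: rv => _ _ _ /cvgryPge; exact. Qed.

(** Doubling: the ratio [g (2 * t) / g t] is eventually below [2 ^ p]. The value at [2 * s0] covers
    the first dyadic interval, and halving the argument reaches it. *)
Let regvar_poly : exists p (A s0 : R), [/\ 0 <= A, 1 <= s0 &
  forall s, s0 <= s -> g s <= A * s ^+ p].
Proof.
have [_ g0 rvx _] := rv.
pose C : R := 2 `^ rho + 1.
have [p Cp] : exists p, C <= 2 ^+ p.
  exists (Num.truncn C).+1; apply: (@le_trans _ _ (Num.truncn C).+1%:R).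
    by rewrite ltW// truncnS_gt.
  by rewrite -natrX ler_nat ltnW// ltn_expl.
have [M [_ HM]] : \forall t \near +oo, 1 <= g t /\ g (2 * t) <= 2 ^+ p * g t.
  have h2 := cvgr_le _ (rvx 2 (ltr0n _ 2)) C.
  near=> t; have g1 : 1 <= g t by near: t; exact: regvar_ge.
  split => //; have : g (2 * t) / g t <= C.
    by near: t; apply: h2; rewrite /C ltrDl.
  rewrite ler_pdivrMr ?(lt_le_trans ltr01)// => /le_trans; apply.
  by rewrite ler_wpM2r// (le_trans ler01).
pose s0 := Num.max 1 (M + 1).
have s01 : 1 <= s0 by rewrite le_max lexx.
have s0M s : s0 <= s -> g (2 * s) <= 2 ^+ p * g s.
  by move=> ss; apply: (HM s _).2; rewrite (lt_le_trans _ ss)// lt_max ltrDl ltr01 orbT.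
have s00 : 0 <= s0 by rewrite (le_trans ler01).
have A0 : 0 <= g (2 * s0) by apply: g0; rewrite mulr_ge0.
exists p, (g (2 * s0)), s0; split => // s ss.
have [k] : exists k, s <= 2 ^+ k * s0.
  exists (Num.truncn s).+1; apply: (@le_trans _ _ ((Num.truncn s).+1%:R * 1)).
    by rewrite mulr1 ltW// truncnS_gt.
  by rewrite ler_pM// -natrX ler_nat ltnW// ltn_expl.
elim: k s ss => [|k IH] s ss sk.
  rewrite expr0 mul1r in sk; have -> : s = s0 by apply/eqP; rewrite eq_le sk.
  apply: le_trans (ler_peMr A0 _); last by rewrite exprn_ege1.
  by apply: regvar_nd => //; rewrite ler_peMl// ler1n.
have [s2|s2] := leP s (2 * s0).
  apply: le_trans (ler_peMr A0 _); last by rewrite exprn_ege1// (le_trans s01).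
  by apply: regvar_nd => //; exact: le_trans ss.
have h1 : s0 <= s / 2 by rewrite ler_pdivlMr// mulrC ltW.
have h2 : s / 2 <= 2 ^+ k * s0 by rewrite ler_pdivrMr// mulrAC -exprSr.
have -> : s = 2 * (s / 2) by field.
apply: le_trans (s0M _ h1) _.
rewrite exprMn mulrCA ler_wpM2l ?exprn_ge0//; exact: IH.
Unshelve. all: by end_near. Qed.

(** At [s = ln n] this says that [G n] is below every power of [n], which makes [ln (G n)]
    negligible against [ln n]. *)
Lemma regvar_subexp (eps : R) : 0 < eps -> \forall s \near +oo, g s <= expR (eps * s).
Proof.
move=> eps0; have [p [A [s0 [A0 s01 Hp]]]] := regvar_poly.
near=> s.
have ss0 : s0 <= s by near: s; apply: nbhs_pinfty_ge; rewrite num_real.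
have s0' : 0 < s by rewrite (lt_le_trans _ ss0)// (lt_le_trans ltr01).
apply: le_trans (Hp s ss0) _.
have e0 : 0 <= eps * s by rewrite mulr_ge0 ?ltW.
apply: le_trans (expR_ge1Dxn p e0).
have f0 : 0 < (p.+1)`!%:R :> R by rewrite ltr0n fact_gt0.
apply: (@le_trans _ _ ((eps * s) ^+ p.+1 / (p.+1)`!%:R)); last by rewrite lerDr.
have -> : (eps * s) ^+ p.+1 = eps ^+ p.+1 * s * s ^+ p.
  by rewrite exprMn [s ^+ p.+1]exprS mulrA.
rewrite ler_pdivlMr// mulrAC ler_wpM2r ?exprn_ge0 ?(ltW s0')//.
have hs : A * (p.+1)`!%:R / eps ^+ p.+1 <= s.
  by near: s; apply: nbhs_pinfty_ge; rewrite num_real.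
by rewrite [leRHS]mulrC -ler_pdivrMr ?exprn_gt0.
Unshelve. all: by end_near. Qed.

(** Regular variation concerns fixed multiples, while [s n] is only asymptotic to [c * r n].
    Monotonicity traps [g (s n)] between the values at [(c - h) * r n] and [(c + h) * r n], and
    continuity of the power closes the gap. *)
Lemma regvar_seq (s r : nat -> R) (c : R) : 0 < c ->
  r n @[n --> \oo] --> +oo -> s n / r n @[n --> \oo] --> c ->
  g (s n) / g (r n) @[n --> \oo] --> c `^ rho.
Proof.
move=> c0 ry sr; have [_ g0 rvx _] := rv.
apply/cvgrPdist_le => eps eps0; have e2 : 0 < eps / 2 by rewrite divr_gt0.
have cont : {for c, continuous (fun y : R => expR (rho * ln y))}.
  apply: continuous_comp; last exact: continuous_expR.
  apply: continuousM; first exact: cst_continuous.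
  exact: continuous_ln.
have /cvgrPdist_le/(_ _ e2)[e /= e0 He] := cont.
pose h := Num.min (e / 2) (c / 2).
have h0 : 0 < h by rewrite lt_min !divr_gt0.
have he : h <= e / 2 by rewrite ge_min lexx.
have hc : h <= c / 2 by rewrite ge_min lexx orbT.
have pE y : 0 < y -> y `^ rho = expR (rho * ln y) by move=> y0; rewrite /powR gt_eqF.
have c1 : 0 < c - h by lra.
have c2 : 0 < c + h by lra.
have H1 : `|c `^ rho - (c - h) `^ rho| <= eps / 2.
  by rewrite !pE//; apply: He; rewrite /ball/= opprB addrCA subrr addr0 gtr0_norm//; lra.
have H2 : `|c `^ rho - (c + h) `^ rho| <= eps / 2.
  by rewrite !pE//; apply: He; rewrite /ball/= opprD addNKr normrN gtr0_norm//; lra.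
have /cvgrPdist_le/(_ _ e2) K1 := cvg_comp _ _ ry (rvx _ c1).
have /cvgrPdist_le/(_ _ e2) K2 := cvg_comp _ _ ry (rvx _ c2).
have /cvgrPdist_le/(_ _ h0) K3 := sr.
have K4 : \forall n \near \oo, 1 <= g (r n) := ry _ (regvar_ge 1).
have K5 : \forall n \near \oo, 1 <= r n by move/cvgryPge : ry; exact.
near=> n.
have k1 : `|(c - h) `^ rho - g ((c - h) * r n) / g (r n)| <= eps / 2 by near: n.
have k2 : `|(c + h) `^ rho - g ((c + h) * r n) / g (r n)| <= eps / 2 by near: n.
have k3 : `|c - s n / r n| <= h by near: n.
have g1 : 0 < g (r n) by apply: (@lt_le_trans _ _ 1) => //; near: n.
have r1 : 0 < r n by apply: (@lt_le_trans _ _ 1) => //; near: n.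
move: k3; rewrite ler_distlC => /andP[k3 k4].
have {}k3 : (c - h) * r n <= s n by rewrite -ler_pdivlMr//; lra.
have {}k4 : s n <= (c + h) * r n by rewrite -ler_pdivrMr//; lra.
have p1 : 0 <= (c - h) * r n by rewrite mulr_ge0 ?ltW.
have q1 : g ((c - h) * r n) / g (r n) <= g (s n) / g (r n).
  by rewrite ler_wpM2r ?invr_ge0 ?(ltW g1)//; apply: regvar_nd.
have q2 : g (s n) / g (r n) <= g ((c + h) * r n) / g (r n).
  by rewrite ler_wpM2r ?invr_ge0 ?(ltW g1)//; apply: regvar_nd => //; exact: le_trans k3.
move: H1 H2 k1 k2; rewrite !ler_distl => /andP[? ?] /andP[? ?] /andP[? ?] /andP[? ?].
apply/andP; split; lra.
Unshelve. all: by end_near. Qed.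

Lemma ln_natr_cvgy : @ln R n%:R @[n --> \oo] --> +oo.
Proof.
apply/cvgryPge => A; near=> n.
rewrite -[A]expRK ler_ln ?posrE ?expR_gt0//; last first.
  by rewrite ltr0n; near: n; exact: nbhs_infty_gt.
near: n; exact: nbhs_infty_ger.
Unshelve. all: by end_near. Qed.

Lemma regvar_ln_cvgy : G n @[n --> \oo] --> +oo.
Proof. by case: rv => _ _ _; exact: (cvg_comp _ _ ln_natr_cvgy). Qed.

Let G_ge A : \forall n \near \oo, A <= G n.
Proof. by have /cvgryPge := regvar_ln_cvgy; exact. Qed.

Let lnn_ge A : \forall n \near \oo, A <= @ln R n%:R.
Proof. by have /cvgryPge := ln_natr_cvgy; exact. Qed.

Let G_le (eps : R) : 0 < eps -> \forall n \near \oo, G n <= expR (eps * ln n%:R).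
Proof. by move=> e0; exact (ln_natr_cvgy (regvar_subexp e0)). Qed.

Lemma scale_lo_cvgy : a n @[n --> \oo] --> +oo.
Proof.
apply/cvgryPge => A; near=> n.
have G0 : 0 < G n.
  by apply: (@lt_le_trans _ _ 1) => //; near: n; exact: G_ge.
have n0 : 0 < n%:R :> R by rewrite ltr0n; near: n; exact: nbhs_infty_gt.
(* [G n] is at most the square root of [n], so [a n] is at least its fourth root. *)
have Gn : G n <= expR (1 / 2 * ln n%:R) by near: n; apply: G_le; lra.
have An : A * 4 <= ln n%:R by near: n; exact: lnn_ge.
apply: (@le_trans _ _ (expR (ln n%:R / 4))).
  by apply: le_trans (expR_ge1Dx _); lra.
rewrite -[leLHS]gtr0_norm ?expR_gt0// -sqrtr_sqr /scale_lo ler_sqrt ?divr_ge0 ?(ltW G0)//.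
rewrite ler_pdivlMr//; apply: le_trans (ler_wpM2l (sqr_ge0 _) Gn) _.
rewrite -expRM_natl -expRD (_ : _ + _ = ln n%:R); last by field.
by rewrite lnK.
Unshelve. all: by end_near. Qed.

Lemma scale_hi_cvgy : b n @[n --> \oo] --> +oo.
Proof.
apply/cvgryPge => A; near=> n.
have G1 : 1 <= G n by near: n; exact: G_ge.
rewrite scale_hiE ?(lt_le_trans ltr01)//.
have aA : Num.max A 0 <= a n by near: n; move/cvgryPge : scale_lo_cvgy; exact.
have [aA1 aA2] : A <= a n /\ 0 <= a n by move: aA; rewrite ge_max => /andP.
by apply: le_trans aA1 _; rewrite ler_peMr.
Unshelve. all: by end_near. Qed.

Let ln_sqrt (x : R) : 0 < x -> ln (Num.sqrt x) = ln x / 2.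
Proof.
move=> x0; rewrite -{2}(sqr_sqrtr (ltW x0)) lnXn ?sqrtr_gt0// -mulr_natr.
by field.
Qed.

(** Both scales meet the hypothesis with equality once [G n >= 1]: [ln (c * a n)] lies
    [ln (G n) / 2] below [ln c + ln n / 2], and [ln (c * b n)] as much above. *)
Let ln_scale_cvg (v : nat -> R) (c : R) :
  (\forall n \near \oo, `|ln (v n) - (ln c + ln n%:R / 2)| <= ln (G n) / 2) ->
  ln (v n) / ln n%:R @[n --> \oo] --> (2^-1 : R).
Proof.
move=> Hv; apply/cvgrPdist_le => eps eps0; near=> n.
have hv : `|ln (v n) - (ln c + ln n%:R / 2)| <= ln (G n) / 2 by near: n.
have L1 : 1 <= @ln R n%:R by near: n; exact: lnn_ge.
have L2 : 2 * `|ln c| / eps <= ln n%:R by near: n; exact: lnn_ge.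
have L0 : 0 < @ln R n%:R by exact: lt_le_trans L1.
have G1 : 1 <= G n by near: n; exact: G_ge.
have GL : G n <= expR (eps * ln n%:R) by near: n; exact: G_le.
have lG : ln (G n) <= eps * ln n%:R.
  by rewrite -[leRHS]expRK ler_ln ?posrE ?expR_gt0// (lt_le_trans ltr01).
rewrite distrC -(ler_pM2r L0) -{2}(gtr0_norm L0) -normrM mulrBl divfK ?gt_eqF//.
rewrite (_ : _ - _ = ln (v n) - (ln c + ln n%:R / 2) + ln c); last by field.
apply: le_trans (ler_normD _ _) _.
rewrite ler_pdivrMr// in L2; lra.
Unshelve. all: by end_near. Qed.

Let half_powR : (2^-1 : R) `^ rho = (2 `^ rho)^-1.
Proof. by rewrite -powR_inv1// -powRrM mulN1r powRN. Qed.

Lemma regvar_scale_lo (c : R) : 0 < c ->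
  g (ln (c * a n)) / G n @[n --> \oo] --> (2 `^ rho)^-1.
Proof.
move=> c0; rewrite -half_powR; apply: regvar_seq => //; first exact: ln_natr_cvgy.
apply: (@ln_scale_cvg _ c); near=> n.
have G1 : 1 <= G n by near: n; exact: G_ge.
have G0 : 0 < G n by exact: lt_le_trans G1.
have n0 : 0 < n%:R :> R by rewrite ltr0n; near: n; exact: nbhs_infty_gt.
rewrite lnM ?posrE ?sqrtr_gt0 ?divr_gt0// ln_sqrt ?divr_gt0// ln_div ?posrE//.
rewrite (_ : _ - _ = - (ln (G n) / 2)); last by field.
by rewrite normrN ger0_norm// divr_ge0// ln_ge0.
Unshelve. all: by end_near. Qed.

Lemma regvar_scale_hi (c : R) : 0 < c ->
  g (ln (c * b n)) / G n @[n --> \oo] --> (2 `^ rho)^-1.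
Proof.
move=> c0; rewrite -half_powR; apply: regvar_seq => //; first exact: ln_natr_cvgy.
apply: (@ln_scale_cvg _ c); near=> n.
have G1 : 1 <= G n by near: n; exact: G_ge.
have G0 : 0 < G n by exact: lt_le_trans G1.
have n0 : 0 < n%:R :> R by rewrite ltr0n; near: n; exact: nbhs_infty_gt.
rewrite lnM ?posrE ?sqrtr_gt0 ?mulr_gt0// ln_sqrt ?mulr_gt0// lnM ?posrE//.
rewrite (_ : _ - _ = ln (G n) / 2); last by field.
by rewrite ger0_norm// divr_ge0// ln_ge0.
Unshelve. all: by end_near. Qed.

(** Successive levels within a bounded factor let a real level [t] be traded for an integer
    index. *)
Lemma scale_lo_succ : \forall n \near \oo, a n.+1 <= 2 * a n.
Proof.
near=> n.
have G0 : 0 < G n.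
  by apply: (@lt_le_trans _ _ 1) => //; near: n; exact: G_ge.
have n0 : 1 <= n%:R :> R by rewrite ler1n; near: n; exact: nbhs_infty_gt.
have GG : G n <= G n.+1.
  apply: regvar_nd; first by rewrite ln_ge0.
  by rewrite ler_ln ?posrE ?ltr0n// ?ler_nat// -(ltr0n R) (lt_le_trans ltr01).
have G0' : 0 < G n.+1 by exact: lt_le_trans GG.
rewrite [leRHS](_ : _ = Num.sqrt (2 ^+ 2 * (n%:R / G n))); last first.
  by rewrite sqrtrM ?sqr_ge0// sqrtr_sqr gtr0_norm.
rewrite ler_sqrt; last first.
  by rewrite mulr_ge0// divr_ge0// ltW.
rewrite mulrA; apply: (@le_trans _ _ (n.+1%:R / G n)).
  by rewrite ler_wpM2l// lef_pV2.
rewrite ler_wpM2r ?invr_ge0 ?ltW// -natr1; lra.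
Unshelve. all: by end_near. Qed.

(** For [n >= 2], [n + 1 <= n ^ 2] gives [ln (n + 1) <= 2 * ln n], and regular variation at 2
    controls [g] there. *)
Lemma scale_hi_succ : exists2 C : R, 1 <= C & \forall n \near \oo, b n.+1 <= C * b n.
Proof.
have [_ g0 rvx _] := rv.
pose K : R := 2 * (2 `^ rho + 1).
have p0 : 0 <= (2 : R) `^ rho by exact: powR_ge0.
have K2 : 2 <= K by rewrite /K; lra.
exists K; first lra.
have h2 : \forall n \near \oo, g (2 * ln n%:R) / g (ln n%:R) <= 2 `^ rho + 1.
  have h1 : (2 : R) `^ rho < 2 `^ rho + 1 by rewrite ltrDl.
  exact (ln_natr_cvgy (cvgr_le _ (rvx 2 (ltr0n _ 2)) _ h1)).
near=> n.
have G0 : 0 < G n.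
  by apply: (@lt_le_trans _ _ 1) => //; near: n; exact: G_ge.
have n2 : (2 <= n)%N by near: n; exact: nbhs_infty_ge.
have n2R : 2 <= n%:R :> R by rewrite ler_nat.
have n0 : 0 < n%:R :> R by lra.
have GG : G n.+1 <= (2 `^ rho + 1) * G n.
  apply: (@le_trans _ _ (g (2 * ln n%:R))).
    apply: regvar_nd; first by rewrite ln_ge0// ler1n.
    rewrite mulr_natl -lnXn// ler_ln ?posrE ?exprn_gt0//.
    have : 0 <= n%:R * (n%:R - 2) :> R by rewrite mulr_ge0//; lra.
    by rewrite -natr1 expr2; lra.
  by rewrite -ler_pdivrMr//; near: n.
have K0 : 0 < K by lra.
rewrite [leRHS](_ : _ = Num.sqrt (K ^+ 2 * (n%:R * G n))); last first.
  by rewrite sqrtrM ?sqr_ge0// sqrtr_sqr gtr0_norm.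
rewrite ler_sqrt; last first.
  by rewrite mulr_ge0 ?sqr_ge0// mulr_ge0// ltW.
apply: (@le_trans _ _ (n.+1%:R * ((2 `^ rho + 1) * G n))).
  by rewrite ler_wpM2l.
rewrite !mulrA ler_wpM2r ?(ltW G0)// -natr1 /K expr2.
have : (n%:R + 1) * (2 `^ rho + 1) <= 2 * n%:R * (2 `^ rho + 1).
  by rewrite ler_wpM2r; lra.
have : 0 <= 2 * n%:R * (2 `^ rho + 1) * (2 * (2 `^ rho + 1) - 1).
  by rewrite !mulr_ge0; lra.
lra.
Unshelve. all: by end_near. Qed.

End regular_variation.

(** * Upper and lower limits *)

Section limf_esup_real.
Context {R : realType} {T : choiceType} {X : filteredType T}.
Implicit Types (f : X -> \bar R) (F : set_system X) (r : \bar R).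
Local Open Scope ereal_scope.

Lemma limf_esup_lt f F {FF : Filter F} r : limf_esup f F < r -> F [set x | f x < r].
Proof.
move=> /ereal_inf_lt[_ [V FV <-] supr]; apply: filterS FV => x Vx /=.
by apply: le_lt_trans supr; apply: ereal_sup_ubound; exists x.
Qed.

Lemma lt_limf_esup f F r : r < limf_esup f F ->
  forall V, F V -> exists2 x, V x & r < f x.
Proof.
move=> rf V FV; have : r < ereal_sup (f @` V).
  by apply: lt_le_trans rf _; apply: ereal_inf_lbound; exists V.
by move=> /ereal_sup_gt[_ [x Vx <-] rx]; exists x.
Qed.

Lemma limf_esup_le f F r : F [set x | f x <= r] -> limf_esup f F <= r.
Proof.
move=> Ff; apply: (@le_trans _ _ (ereal_sup (f @` [set x | f x <= r]))).
  by apply: ereal_inf_lbound; exists [set x | f x <= r].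
by apply: ge_ereal_sup => _ [x /= xr <-].
Qed.

Lemma le_limf_esup f F r : (forall V, F V -> exists2 x, V x & r <= f x) ->
  r <= limf_esup f F.
Proof.
move=> Ff; apply: le_ereal_inf_tmp => _ [V /Ff[x Vx rx] <-].
by apply: le_trans rx _; apply: ereal_sup_ubound; exists x.
Qed.

Lemma limf_einf_gt f F {FF : Filter F} r : r < limf_einf f F -> F [set x | r < f x].
Proof.
rewrite /limf_einf lteNr => /limf_esup_lt; apply: filterS => x /=.
by rewrite lteN2.
Qed.

Lemma gt_limf_einf f F r : limf_einf f F < r ->
  forall V, F V -> exists2 x, V x & f x < r.
Proof.
rewrite /limf_einf lteNl => /lt_limf_esup h V /h[x Vx xr]; exists x => //.
by move: xr; rewrite lteN2.
Qed.

Lemma limf_einf_ge f F {FF : Filter F} r : F [set x | r <= f x] -> r <= limf_einf f F.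
Proof.
move=> Ff; rewrite /limf_einf leeNr; apply: limf_esup_le.
by apply: filterS Ff => x /=; rewrite leeN2.
Qed.

Lemma ge_limf_einf f F r : (forall V, F V -> exists2 x, V x & f x <= r) ->
  limf_einf f F <= r.
Proof.
move=> Ff; rewrite /limf_einf leeNl; apply: le_limf_esup => V /Ff[x Vx xr].
by exists x => //; rewrite leeN2.
Qed.

End limf_esup_real.

Section ereal_density.
Context {R : realType}.
Implicit Types (x y : \bar R).
Local Open Scope ereal_scope.

Lemma ereal_between x y : x < y -> exists q : R, x < q%:E < y.
Proof.
case: x y => [x||] [y||] //; rewrite ?lte_fin => xy.
- by exists ((x + y) / 2)%R; rewrite !lte_fin; apply/andP; split; lra.
- by exists (x + 1)%R; rewrite lte_fin ltrDl ltr01 ltry.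
- by exists (y - 1)%R; rewrite lte_fin ltrBlDr ltrDl ltr01 ltNyr.
- by exists 0%R; rewrite ltNyr ltry.
Qed.

Lemma le_of_real_ub x y : (forall q : R, y < q%:E -> x <= q%:E) -> x <= y.
Proof.
move=> h; rewrite leNgt; apply/negP => /ereal_between[q /andP[yq qx]].
by have := h q yq; rewrite leNgt qx.
Qed.

Lemma le_of_real_lb x y : (forall q : R, q%:E < x -> q%:E <= y) -> x <= y.
Proof.
move=> h; rewrite leNgt; apply/negP => /ereal_between[q /andP[yq qx]].
by have := h q qx; rewrite leNgt yq.
Qed.

Lemma elog_ratio_le (G p q : R) : (0 < G)%R -> (0 <= p)%R ->
  (elog p%:E * (G^-1)%:E <= q%:E) = (p <= expR (q * G))%R.
Proof.
move=> G0 p0; rewrite /elog; case: ifPn => [pn|].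
  rewrite gt0_mulNye ?lte_fin ?invr_gt0// leNye.
  by rewrite (le_trans pn) ?expR_ge0.
rewrite -ltNge => pp; rewrite -EFinM lee_fin ler_pdivrMr//.
by rewrite -{2}(lnK pp) ler_expR.
Qed.

Lemma elog_ratio_ge (G p q : R) : (0 < G)%R -> (0 <= p)%R ->
  (q%:E <= elog p%:E * (G^-1)%:E) = (expR (q * G) <= p)%R.
Proof.
move=> G0 p0; rewrite /elog; case: ifPn => [pn|].
  rewrite gt0_mulNye ?lte_fin ?invr_gt0//.
  rewrite leeNy_eq/=; apply/esym/negbTE; rewrite -ltNge.
  by apply: le_lt_trans pn _; exact: expR_gt0.
rewrite -ltNge => pp; rewrite -EFinM lee_fin ler_pdivlMr//.
by rewrite -{2}(lnK pp) ler_expR.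
Qed.

End ereal_density.

(** * From the three estimates to the limits *)

Section rates.
Context {R : realType}.
Variables (rho : R) (g : R -> R).
Hypothesis rv : regvar_class rho g.
Variables (s2 : R) (H : R -> R) (D : R -> nat -> R).
Local Notation G := (fun n : nat => g (ln n%:R)).
Local Notation a := (scale_lo G).
Local Notation b := (scale_hi G).
Local Notation k := ((2 `^ rho)^-1).
Hypotheses (H0 : forall t, 0 <= H t) (Hnincr : forall s t, s <= t -> H t <= H s).
Hypotheses (D0 : forall x n, 0 <= D x n) (D1 : forall x n, D x n <= 1).
Hypotheses (Dupper : upper_estimate s2 G H D) (Dgauss : gauss_estimate s2 G D)
  (Djump : jump_estimate G H D).

Let G_ge A : \forall n \near \oo, A <= G n.
Proof. by have /cvgryPge := regvar_ln_cvgy rv; exact. Qed.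

Let a_ge A : \forall n \near \oo, A <= a n.
Proof. by have /cvgryPge := scale_lo_cvgy rv; exact. Qed.

Let b_ge A : \forall n \near \oo, A <= b n.
Proof. by have /cvgryPge := scale_hi_cvgy rv; exact. Qed.

Let k0 : 0 < k.
Proof. by rewrite invr_gt0 powR_gt0. Qed.

Let G_expR (K eps : R) : 0 < eps -> \forall n \near \oo, K * G n <= expR (eps * G n).
Proof.
move=> e0; near=> n.
have G1 : 1 <= G n by near: n; exact: G_ge.
have G0 : 0 < G n by exact: lt_le_trans G1.
have Ge : 2 * K / eps ^+ 2 <= G n by near: n; exact: G_ge.
have eG : 0 <= eps * G n by rewrite mulr_ge0 ?ltW.
have h := expR_ge_taylor2 eG.
rewrite ler_pdivrMr ?exprn_gt0// in Ge.
have : 2 * K * G n <= G n * eps ^+ 2 * G n by rewrite ler_pM2r.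
have -> : G n * eps ^+ 2 * G n = (eps * G n) ^+ 2 by ring.
lra.
Unshelve. all: by end_near. Qed.

(* [t] is within a constant factor of a sequence [v] with [ln (v n) ~ ln n / 2] *)
Let regvar_sandwich (v : nat -> R) (r c C eps : R) : 0 < c -> 0 < C -> 0 < eps ->
  (forall A, \forall n \near \oo, A <= v n) ->
  (forall c', 0 < c' -> g (ln (c' * v n)) / G n @[n --> \oo] --> k) ->
  \forall n \near \oo, forall t, c * v n <= t -> t <= C * v n ->
    0 < t /\ `|r * g (ln t) - r * k * G n| <= eps * G n.
Proof.
move=> c0 C0 eps0 vge vk.
pose delta := eps / (`|r| + 1).
have r1 : 0 < `|r| + 1 by rewrite ltr_wpDl.
have delta0 : 0 < delta by rewrite divr_gt0.
have /cvgrPdist_le/(_ _ delta0) K1 := vk _ c0.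
have /cvgrPdist_le/(_ _ delta0) K2 := vk _ C0.
near=> n => t ct tC.
have G1 : 1 <= G n by near: n; exact: G_ge.
have G0 : 0 < G n by exact: lt_le_trans G1.
have vc : c^-1 <= v n by near: n; exact: vge.
have c1 : 1 <= c * v n by rewrite mulrC -ler_pdivrMr// div1r.
have t1 : 1 <= t by exact: le_trans ct.
have t0 : 0 < t by exact: lt_le_trans t1.
split => //.
have k1 : `|k - g (ln (c * v n)) / G n| <= delta by near: n.
have k2 : `|k - g (ln (C * v n)) / G n| <= delta by near: n.
have g1 : g (ln (c * v n)) <= g (ln t).
  apply: (regvar_nd rv); first by rewrite ln_ge0.
  by rewrite ler_ln ?posrE// (lt_le_trans ltr01).
have g2 : g (ln t) <= g (ln (C * v n)).
  apply: (regvar_nd rv); first by rewrite ln_ge0.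
  by rewrite ler_ln ?posrE// (lt_le_trans t0).
rewrite ler_distlC in k1; rewrite ler_distlC in k2.
move: k1 k2 => /andP[k1 _] /andP[_ k2].
rewrite ler_pdivlMr// in k1; rewrite ler_pdivrMr// in k2.
rewrite -mulrA -mulrBr normrM.
have h : `|g (ln t) - k * G n| <= delta * G n.
  by rewrite ler_distl; apply/andP; split; lra.
apply: le_trans (ler_wpM2l (normr_ge0 r) h) _.
rewrite mulrA ler_pM2r// /delta mulrA ler_pdivrMr//.
by rewrite mulrC ler_pM2l// lerDl.
Unshelve. all: by end_near. Qed.

(** Since [n = a ^ 2 * G], monotonicity of [H] bounds [n * H (c * a n)] by [(C / c) ^ 2 * G n] times
    [t ^ 2 * H t]; [G_expR] absorbs the prefactor and [regvar_sandwich] replaces [g (ln t)] by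
    [k * G n]. *)
Let tail_to_jump_ub (r c C eps : R) : 0 < c -> 0 < C -> 0 < eps ->
  \forall n \near \oo, forall t, t <= c * a n -> c * a n <= C * t ->
    t ^+ 2 * H t <= expR (r * g (ln t)) ->
    n%:R * H (c * a n) <= expR ((r * k + eps) * G n).
Proof.
move=> c0 C0 eps0; have e2 : 0 < eps / 2 by rewrite divr_gt0.
have cC : 0 < c / C by rewrite divr_gt0.
have SW := @regvar_sandwich a r _ _ _ cC c0 e2 a_ge (regvar_scale_lo rv).
near=> n => t tc cCt Ht.
have G1 : 1 <= G n by near: n; exact: G_ge.
have G0 : 0 < G n by exact: lt_le_trans G1.
have [t0 hg] : 0 < t /\ `|r * g (ln t) - r * k * G n| <= eps / 2 * G n.
  move: t tc cCt Ht; near: n; apply: filterS SW => n h t tc cCt _; apply: h => //.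
  by rewrite mulrAC ler_pdivrMr// [t * _]mulrC.
have a0 : 0 < a n by have := lt_le_trans t0 tc; rewrite pmulr_rgt0.
have aE : n%:R = a n ^+ 2 * G n by rewrite scale_lo_sqr// divfK// gt_eqF.
have hK : (C / c) ^+ 2 * G n <= expR (eps / 2 * G n) by near: n; exact: G_expR.
have an : a n <= C / c * t by rewrite mulrAC ler_pdivlMr// mulrC.
have an2 : a n ^+ 2 <= (C / c) ^+ 2 * t ^+ 2.
  by rewrite -exprMn lerXn2r ?nnegrE ?(ltW a0)// (le_trans (ltW a0)).
apply: (@le_trans _ _ ((C / c) ^+ 2 * G n * (t ^+ 2 * H t))).
  apply: (@le_trans _ _ (n%:R * H t)); first by rewrite ler_wpM2l// Hnincr.
  rewrite {1}aE; have : a n ^+ 2 * (G n * H t) <= (C / c) ^+ 2 * t ^+ 2 * (G n * H t).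
    by rewrite ler_wpM2r// mulr_ge0// ltW.
  lra.
apply: (@le_trans _ _ (expR (eps / 2 * G n) * expR (r * g (ln t)))).
  by apply: ler_pM => //; rewrite mulr_ge0 ?sqr_ge0// ltW.
rewrite -expRD ler_expR.
by move: hg; rewrite ler_distl => /andP[_]; lra.
Unshelve. all: by end_near. Qed.

Let tail_to_jump_lb (r u C eps : R) : 0 < u -> 0 < C -> 0 < eps ->
  \forall n \near \oo, forall t, u * b n <= t -> t <= C * (u * b n) ->
    expR (r * g (ln t)) <= t ^+ 2 * H t ->
    expR ((r * k - eps) * G n) <= n%:R * H (u * b n).
Proof.
move=> u0 C0 eps0; have e2 : 0 < eps / 2 by rewrite divr_gt0.
have Cu : 0 < C * u by rewrite mulr_gt0.
have SW := @regvar_sandwich b r _ _ _ u0 Cu e2 b_ge (regvar_scale_hi rv).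
near=> n => t ut tC Ht.
have G1 : 1 <= G n by near: n; exact: G_ge.
have G0 : 0 < G n by exact: lt_le_trans G1.
have [t0 hg] : 0 < t /\ `|r * g (ln t) - r * k * G n| <= eps / 2 * G n.
  move: t ut tC Ht; near: n; apply: filterS SW => n h t ut tC _; apply: h => //.
  by rewrite -mulrA.
have bE : b n ^+ 2 = n%:R * G n by rewrite /scale_hi sqr_sqrtr// mulr_ge0 ?(ltW G0).
have hK : (C * u) ^+ 2 * G n <= expR (eps / 2 * G n) by near: n; exact: G_expR.
have tb2 : t ^+ 2 <= (C * u) ^+ 2 * (n%:R * G n).
  rewrite -bE -exprMn lerXn2r ?nnegrE ?(ltW t0)//; first by rewrite mulrA in tC; rewrite (le_trans (ltW t0)).
  by rewrite -mulrA.
have K0 : 0 < (C * u) ^+ 2 * G n by rewrite mulr_gt0 ?exprn_gt0.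
rewrite -(ler_pM2l K0).
apply: (@le_trans _ _ (expR (eps / 2 * G n) * expR ((r * k - eps) * G n))).
  by rewrite ler_pM2r ?expR_gt0.
apply: (@le_trans _ _ (t ^+ 2 * H t)).
  apply: le_trans Ht; rewrite -expRD ler_expR.
  by move: hg; rewrite ler_distl => /andP[+ _]; lra.
apply: (@le_trans _ _ ((C * u) ^+ 2 * (n%:R * G n) * H t)); first by rewrite ler_wpM2r.
have : (C * u) ^+ 2 * G n * n%:R * H t <= (C * u) ^+ 2 * G n * n%:R * H (u * b n).
  by rewrite ler_wpM2l ?Hnincr// mulr_ge0// ltW.
lra.
Unshelve. all: by end_near. Qed.

(** [n.+1] is the first index from [N] on at which [v] exceeds [t]. *)
Let bracket (v : nat -> R) N : (forall A, \forall n \near \oo, A <= v n) ->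
  forall t, v N <= t -> exists n, [/\ (N <= n)%N, v n <= t & t < v n.+1].
Proof.
move=> vge t vt.
have exm : exists m, (N <= m)%N && (t < v m).
  have [M _ HM] := vge (t + 1).
  exists (maxn N M); rewrite leq_maxl/= (@lt_le_trans _ _ (t + 1))//.
    by rewrite ltrDl.
  exact: (HM _ (leq_maxr N M)).
case: (ex_minnP exm) => -[|m'] /andP[Nm tm] mmin.
  by move: Nm vt tm; rewrite leqn0 => /eqP -> vt; rewrite ltNge vt.
exists m'; have Nm' : (N <= m')%N.
  rewrite leqNgt; apply/negP => m'N.
  have NE : N = m'.+1 by apply/eqP; rewrite eqn_leq Nm.
  by move: tm; rewrite -NE ltNge vt.
split => //; rewrite leNgt; apply/negP => tm'.
by have := mmin m'; rewrite Nm' tm' ltnn => /(_ isT).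
Qed.

Let freq_tail_ub (r c eps : R) : 0 < c -> 0 < eps ->
  (forall V, (pinfty_nbhs R) V ->
     exists2 t, V t & t ^+ 2 * H t <= expR (r * g (ln t))) ->
  forall N, exists2 n, (N <= n)%N & n%:R * H (c * a n) <= expR ((r * k + eps) * G n).
Proof.
move=> c0 eps0 freq N.
have [M1 _ HM1] := @tail_to_jump_ub r c 2 eps c0 (ltr0n _ 2) eps0.
have [M2 _ HM2] := scale_lo_succ rv.
pose M := maxn N (maxn M1 M2).
have ca_ge A : \forall n \near \oo, A <= c * a n.
  near=> n; rewrite mulrC -ler_pdivrMr//; near: n; exact: a_ge.
have [|t /= tM Ht] := freq [set t | c * a M <= t].
  by apply: nbhs_pinfty_ge; rewrite num_real.
have [n [Mn nt tn]] := @bracket (fun n => c * a n) M ca_ge t tM.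
have [Nn M1n M2n] : [/\ (N <= n)%N, (M1 <= n)%N & (M2 <= n)%N].
  by move: Mn; rewrite !geq_max => /and3P.
(* The upper end of the bracket: [t <= c * a n.+1] makes [H (c * a n.+1) <= H t]. *)
exists n.+1; first exact: leqW.
apply: (HM1 n.+1 (leqW M1n) t) => //; first exact: ltW.
have := HM2 n M2n => /= h2.
apply: (@le_trans _ _ (c * (2 * a n))); first by rewrite ler_pM2l.
by rewrite mulrCA ler_pM2l.
Unshelve. all: by end_near. Qed.

Let freq_tail_lb (r u eps : R) : 0 < u -> 0 < eps ->
  (forall V, (pinfty_nbhs R) V ->
     exists2 t, V t & expR (r * g (ln t)) <= t ^+ 2 * H t) ->
  forall N, exists2 n, (N <= n)%N & expR ((r * k - eps) * G n) <= n%:R * H (u * b n).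
Proof.
move=> u0 eps0 freq N.
have [C C1 [M2 _ HM2]] := scale_hi_succ rv.
have C0 : 0 < C by exact: lt_le_trans C1.
have [M1 _ HM1] := @tail_to_jump_lb r u C eps u0 C0 eps0.
pose M := maxn N (maxn M1 M2).
have ub_ge A : \forall n \near \oo, A <= u * b n.
  near=> n; rewrite mulrC -ler_pdivrMr//; near: n; exact: b_ge.
have [|t /= tM Ht] := freq [set t | u * b M <= t].
  by apply: nbhs_pinfty_ge; rewrite num_real.
have [n [Mn nt tn]] := @bracket (fun n => u * b n) M ub_ge t tM.
have [Nn M1n M2n] : [/\ (N <= n)%N, (M1 <= n)%N & (M2 <= n)%N].
  by move: Mn; rewrite !geq_max => /and3P.
(* The lower end of the bracket this time: [u * b n <= t] makes [H t <= H (u * b n)]. *)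
exists n => //; apply: (HM1 n M1n t) => //.
have := HM2 n M2n => /= h2.
apply: le_trans (ltW tn) _; rewrite mulrCA ler_pM2l//.
Unshelve. all: by end_near. Qed.

Let near_tail_ub (r c eps : R) : 0 < c -> 0 < eps ->
  (\forall t \near +oo, t ^+ 2 * H t <= expR (r * g (ln t))) ->
  \forall n \near \oo, n%:R * H (c * a n) <= expR ((r * k + eps) * G n).
Proof.
move=> c0 eps0 [M [_ HM]].
have H1 := @tail_to_jump_ub r c 1 eps c0 ltr01 eps0.
near=> n; have h : forall t, t <= c * a n -> c * a n <= 1 * t ->
    t ^+ 2 * H t <= expR (r * g (ln t)) ->
    n%:R * H (c * a n) <= expR ((r * k + eps) * G n) by near: n.
apply: (h (c * a n)) => //; first by rewrite mul1r.
apply: HM; rewrite mulrC -ltr_pdivrMr//.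
apply: (@lt_le_trans _ _ (M / c + 1)); first by rewrite ltrDl.
by near: n; exact: a_ge.
Unshelve. all: by end_near. Qed.

Let near_tail_lb (r u eps : R) : 0 < u -> 0 < eps ->
  (\forall t \near +oo, expR (r * g (ln t)) <= t ^+ 2 * H t) ->
  \forall n \near \oo, expR ((r * k - eps) * G n) <= n%:R * H (u * b n).
Proof.
move=> u0 eps0 [M [_ HM]].
have H1 := @tail_to_jump_lb r u 1 eps u0 ltr01 eps0.
near=> n; have h : forall t, u * b n <= t -> t <= 1 * (u * b n) ->
    expR (r * g (ln t)) <= t ^+ 2 * H t ->
    expR ((r * k - eps) * G n) <= n%:R * H (u * b n) by near: n.
apply: (h (u * b n)) => //; first by rewrite mul1r.
apply: HM; rewrite mulrC -ltr_pdivrMr//.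
apply: (@lt_le_trans _ _ (M / u + 1)); first by rewrite ltrDl.
by near: n; exact: b_ge.
Unshelve. all: by end_near. Qed.

(** An implication at each large [n], so that it combines with a tail bound known eventually (for
    the limsup) or only frequently (for the liminf). *)
Let upper_step (x r q : R) : 0 < x -> q < 0 -> r * k < q -> - (x ^+ 2 / (2 * s2)) < q ->
  exists c eps : R, [/\ 0 < c, 0 < eps & \forall n \near \oo,
    n%:R * H (c * a n) <= expR ((r * k + eps) * G n) -> D x n <= expR (q * G n)].
Proof.
move=> x0 q0 rq xq; set A := x ^+ 2 / (2 * s2) in xq *.
(* A quarter of the smaller gap below [q]; it also serves as [kappa], and [q < 0] then keeps the
   correction inside the exponential below 1. *)
pose eps := Num.min (q - r * k) (q + A) / 4.
have m0 : 0 < Num.min (q - r * k) (q + A) by rewrite lt_min; apply/andP; split; lra.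
have e0 : 0 < eps by rewrite divr_gt0.
have e1 : eps * 4 <= q - r * k by rewrite /eps divfK// ge_min lexx.
have e2 : eps * 4 <= q + A by rewrite /eps divfK// ge_min lexx orbT.
have [c c0 Hc] := Dupper x0 e0.
exists c, eps; split => //; have {}Hc := Hc eps e0.
near=> n => hn.
have G1 : 1 <= G n by near: n; exact: G_ge.
have G0 : 0 < G n by exact: lt_le_trans G1.
have hD : D x n <= n%:R * H (c * a n) + expR (- (A - eps) * G n +
    n%:R * (expR (eps * G n) * H (c * a n))) by near: n.
have h1 : n%:R * (expR (eps * G n) * H (c * a n)) <= 1.
  rewrite mulrCA; apply: le_trans (ler_wpM2l (expR_ge0 _) hn) _.
  rewrite -expRD expR_le1 -mulrDl pmulr_lle0//; lra.
have h2 : n%:R * H (c * a n) <= expR (q * G n) * expR (- (eps * G n)).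
  apply: le_trans hn _; rewrite -expRD ler_expR.
  have : (eps * 4) * G n <= (q - r * k) * G n by rewrite ler_pM2r.
  have : 0 < eps * G n by rewrite mulr_gt0.
  lra.
have h3 : expR (- (A - eps) * G n + n%:R * (expR (eps * G n) * H (c * a n))) <=
    expR (q * G n) * expR (1 - 2 * (eps * G n)).
  rewrite -expRD ler_expR.
  have : (eps * 4) * G n <= (q + A) * G n by rewrite ler_pM2r.
  have : 0 < eps * G n by rewrite mulr_gt0.
  lra.
have big : 4 <= eps * G n.
  by rewrite mulrC -ler_pdivrMr//; near: n; exact: G_ge.
have h4 : expR (- (eps * G n)) <= 1 / 2.
  rewrite expRN div1r lef_pV2 ?posrE ?expR_gt0//.
  by apply: le_trans (expR_ge1Dx _); lra.
have h5 : expR (1 - 2 * (eps * G n)) <= 1 / 2.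
  apply: le_trans h4; rewrite ler_expR; lra.
have q1 : 0 < expR (q * G n) := expR_gt0 _.
have := ler_wpM2l (ltW q1) h4; have := ler_wpM2l (ltW q1) h5; lra.
Unshelve. all: by end_near. Qed.

Let lower_step (x r q : R) : 0 < x -> q < r * k ->
  exists u eps : R, [/\ 0 < u, 0 < eps & \forall n \near \oo,
    expR ((r * k - eps) * G n) <= n%:R * H (u * b n) -> expR (q * G n) <= D x n].
Proof.
move=> x0 rq; pose eps := (r * k - q) / 2; have e0 : 0 < eps by rewrite divr_gt0// subr_gt0.
have [u u0 Hu] := Djump x0; exists u, eps; split => //.
apply: filterS (Hu eps e0) => n hD hn; apply: le_trans hD.
apply: (@le_trans _ _ (expR ((r * k - eps) * G n) * expR (- eps * G n))).
  by rewrite -expRD -mulrDl /eps (_ : _ + _ = q)//; field.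
by rewrite ler_wpM2r// expR_ge0.
Qed.

Let gauss_step (x q : R) : 0 < x -> q < - (x ^+ 2 / (2 * s2)) ->
  \forall n \near \oo, expR (q * G n) <= D x n.
Proof.
move=> x0 xq; have e0 : 0 < - (x ^+ 2 / (2 * s2)) - q by lra.
apply: filterS (Dgauss x0 e0) => n; apply: le_trans.
by rewrite ler_expR (_ : - (_ + _) = q)//; ring.
Qed.

Local Notation tau := (fun t => tail_ratio g t (H t)%:E).
Local Notation dev x := (fun n => seq_ratio g n (D x n)%:E).

Let tau_le (q : R) : \forall t \near +oo,
  (tau t <= q%:E)%E = (t ^+ 2 * H t <= expR (q * g (ln t))).
Proof.
have lny : @ln R t @[t --> +oo] --> +oo.
  apply/cvgryPge => A; near=> t.
  have tA : expR A <= t by near: t; apply: nbhs_pinfty_ge; rewrite num_real.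
  by rewrite -[A]expRK ler_ln ?posrE ?expR_gt0// (lt_le_trans (expR_gt0 A)).
have gy : \forall t \near +oo, 1 <= g (ln t) := lny _ (regvar_ge rv 1).
apply: filterS gy => t g1; rewrite /tail_ratio -EFinM elog_ratio_le//.
  exact: lt_le_trans g1.
by rewrite mulr_ge0 ?sqr_ge0.
Unshelve. all: by end_near. Qed.

Let tau_ge (q : R) : \forall t \near +oo,
  (q%:E <= tau t)%E = (expR (q * g (ln t)) <= t ^+ 2 * H t).
Proof.
have lny : @ln R t @[t --> +oo] --> +oo.
  apply/cvgryPge => A; near=> t.
  have tA : expR A <= t by near: t; apply: nbhs_pinfty_ge; rewrite num_real.
  by rewrite -[A]expRK ler_ln ?posrE ?expR_gt0// (lt_le_trans (expR_gt0 A)).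
have gy : \forall t \near +oo, 1 <= g (ln t) := lny _ (regvar_ge rv 1).
apply: filterS gy => t g1; rewrite /tail_ratio -EFinM elog_ratio_ge//.
  exact: lt_le_trans g1.
by rewrite mulr_ge0 ?sqr_ge0.
Unshelve. all: by end_near. Qed.

Let dev_le x (q : R) : \forall n \near \oo,
  (dev x n <= q%:E)%E = (D x n <= expR (q * G n)).
Proof.
apply: filterS (G_ge 1) => n g1; rewrite /seq_ratio elog_ratio_le//.
exact: lt_le_trans g1.
Qed.

Let dev_ge x (q : R) : \forall n \near \oo,
  (q%:E <= dev x n)%E = (expR (q * G n) <= D x n).
Proof.
apply: filterS (G_ge 1) => n g1; rewrite /seq_ratio elog_ratio_ge//.
exact: lt_le_trans g1.
Qed.

(** The parameters are opposites of limits, so the opposite of the minimum is a maximum: to lie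
    below a threshold both terms must, to lie above it one suffices. *)
Lemma oppe_rate x (l : \bar R) :
  (- rate s2 rho x (- l) = Order.max (- (x ^+ 2 / (2 * s2))%:E) (l * k%:E))%E.
Proof. by rewrite /rate oppe_min mulNe oppeK. Qed.

Let rate_lt x (l : \bar R) (q : R) : (- rate s2 rho x (- l) < q%:E)%E ->
  - (x ^+ 2 / (2 * s2)) < q /\ (exists2 r : R, (l < r%:E)%E & r * k < q).
Proof.
rewrite oppe_rate gt_max => /andP[h1 h2]; split; first by rewrite -lte_fin EFinN.
have p0 : 0 < 2 `^ rho by rewrite powR_gt0.
have : (l < (q * 2 `^ rho)%:E)%E.
  rewrite EFinM -lte_pdivrMr//.
by move=> /ereal_between[r /andP[lr rq]]; exists r => //; rewrite ltr_pdivrMr// -lte_fin.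
Qed.

Let lt_rate x (l : \bar R) (q : R) : (q%:E < - rate s2 rho x (- l))%E ->
  q < - (x ^+ 2 / (2 * s2)) \/ (exists2 r : R, (r%:E < l)%E & q < r * k).
Proof.
rewrite oppe_rate lt_max => /orP[h1|h2]; [left|right]; first by rewrite -lte_fin EFinN.
have p0 : 0 < 2 `^ rho by rewrite powR_gt0.
have : ((q * 2 `^ rho)%:E < l)%E.
  by rewrite EFinM -lte_pdivlMr.
by move=> /ereal_between[r /andP[qr rl]]; exists r => //; rewrite ltr_pdivlMr// -lte_fin.
Qed.

(** A real above the limsup of [tau] bounds the tail eventually, a real below it does so frequently.
    [limn_einf_rate] exchanges the two roles. *)
Theorem limn_esup_rate x : 0 < x ->
  limn_esup (dev x) = (- rate s2 rho x (- limf_esup tau (pinfty_nbhs R)))%E.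
Proof.
move=> x0; apply/eqP; rewrite eq_le; apply/andP; split.
  apply: le_of_real_ub => q /rate_lt[xq [r lr rq]].
  apply: limf_esup_le.
  (* [upper_step] handles negative thresholds; for the others [D <= 1] is enough. *)
  have [q0|q0] := leP 0 q.
    apply: filterS2 (G_ge 0) (dev_le x q) => n h1 h2 /=; rewrite h2.
    by apply: le_trans (D1 _ _) _; rewrite -[leLHS]expR0 ler_expR mulr_ge0.
  have [c [eps [c0 e0 Hs]]] := upper_step x0 q0 rq xq.
  have tr : \forall t \near +oo, t ^+ 2 * H t <= expR (r * g (ln t)).
    apply: filterS2 (limf_esup_lt lr) (tau_le r) => t /ltW h <-; exact: h.
  have hn := near_tail_ub c0 e0 tr.
  apply: filterS3 Hs hn (dev_le x q) => n h1 h2 h3 /=; rewrite h3; exact: h1.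
apply: le_of_real_lb => q /lt_rate[xq|[r rl rq]]; apply: le_limf_esup => V [N _ NV].
  have [M _ HM] := filterI (gauss_step x0 xq) (dev_ge x q).
  have [h1 h2] := HM (maxn N M) (leq_maxr _ _).
  by exists (maxn N M); [apply: NV; exact: leq_maxl|rewrite h2].
have [u [eps [u0 e0 Hs]]] := lower_step x0 rq.
have tr : forall V, (pinfty_nbhs R) V ->
     exists2 t, V t & expR (r * g (ln t)) <= t ^+ 2 * H t.
  move=> W FW; have [t [Wt h]] := lt_limf_esup rl (filterI FW (tau_ge r)).
  by move=> /ltW; rewrite h => ?; exists t.
have [M _ HM] := filterI Hs (dev_ge x q).
have [n Mn hn] := freq_tail_lb u0 e0 tr (maxn N M).
have [h1 h2] := HM n (leq_trans (leq_maxr _ _) Mn).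
exists n; first by apply: NV; exact: leq_trans (leq_maxl _ _) Mn.
by rewrite h2; exact: h1.
Unshelve. all: by end_near. Qed.

Theorem limn_einf_rate x : 0 < x ->
  limn_einf (dev x) = (- rate s2 rho x (- limf_einf tau (pinfty_nbhs R)))%E.
Proof.
move=> x0; rewrite -[LHS]/(limf_einf (dev x) \oo).
apply/eqP; rewrite eq_le; apply/andP; split.
  apply: le_of_real_ub => q /rate_lt[xq [r lr rq]].
  apply: ge_limf_einf => V [N _ NV].
  have [q0|q0] := leP 0 q.
    have [M _ HM] := filterI (G_ge 0) (dev_le x q).
    have [h1 h2] := HM (maxn N M) (leq_maxr _ _).
    exists (maxn N M); [by apply: NV; exact: leq_maxl|rewrite h2].
    by apply: le_trans (D1 _ _) _; rewrite -[leLHS]expR0 ler_expR mulr_ge0.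
  have [c [eps [c0 e0 Hs]]] := upper_step x0 q0 rq xq.
  have tr : forall V, (pinfty_nbhs R) V ->
      exists2 t, V t & t ^+ 2 * H t <= expR (r * g (ln t)).
    move=> W FW; have [t [Wt h]] := gt_limf_einf lr (filterI FW (tau_le r)).
    by move=> /ltW; rewrite h => ?; exists t.
  have [M _ HM] := filterI Hs (dev_le x q).
  have [n Mn hn] := freq_tail_ub c0 e0 tr (maxn N M).
  have [h1 h2] := HM n (leq_trans (leq_maxr _ _) Mn).
  exists n; first by apply: NV; exact: leq_trans (leq_maxl _ _) Mn.
  by rewrite h2; exact: h1.
apply: le_of_real_lb => q /lt_rate[xq|[r rl rq]]; apply: limf_einf_ge.
  by apply: filterS2 (gauss_step x0 xq) (dev_ge x q) => n h1 h2 /=; rewrite h2.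
have [u [eps [u0 e0 Hs]]] := lower_step x0 rq.
have tr : \forall t \near +oo, expR (r * g (ln t)) <= t ^+ 2 * H t.
  apply: filterS2 (limf_einf_gt rl) (tau_ge r) => t /ltW h <-; exact: h.
have hn := near_tail_lb u0 e0 tr.
apply: filterS3 Hs hn (dev_ge x q) => n h1 h2 h3 /=; rewrite h3; exact: h1.
Qed.

End rates.

(** * Convergence at every level and equality of the parameters *)

Section rate_limits.
Context {R : realType}.
Variables (s2 rho : R).
Hypothesis s20 : 0 < s2.
Local Notation k := ((2 `^ rho)^-1).
Implicit Types (l : \bar R) (U : R -> nat -> \bar R).
Local Open Scope ereal_scope.

Lemma cvg_of_limn_esup_einf (u : nat -> \bar R) l :
  limn_esup u = l -> limn_einf u = l -> u @ \oo --> l.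
Proof.
move=> us ui; apply: (@squeeze_cvge _ _ _ _ (einfs u) u (esups u)).
- apply: nearW => n; apply/andP; split.
    by apply: ereal_inf_lbound; exists n => /=.
  by apply: ereal_sup_ubound; exists n => /=.
- by rewrite -ui limn_einf_lim; exact: is_cvg_einfs.
- by rewrite -us limn_esup_lim; exact: is_cvg_esups.
Qed.

Let k0 : (0 < k)%R.
Proof. by rewrite invr_gt0 powR_gt0. Qed.

(** The Gaussian term hides the parameter at small [x]. Choosing [x] so that it reaches a real
    strictly between the two scaled parameters lets the difference appear. *)
Let rate_lt l l' : l < l' -> exists2 x : R, (0 < x)%R &
  rate s2 rho x l < rate s2 rho x l'.
Proof.
move=> ll'; have : l * k%:E < l' * k%:E by rewrite lte_pmul2r ?lte_fin.
move=> /ereal_between[y /andP[ly yl']].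
pose A := Num.max y 1%R; have A0 : (0 < A)%R by rewrite lt_max ltr01 orbT.
exists (Num.sqrt (2 * s2 * A)).
  by rewrite sqrtr_gt0 !mulr_gt0.
have E : (Num.sqrt (2 * s2 * A) ^+ 2 / (2 * s2) = A)%R.
  rewrite sqr_sqrtr; first by field; rewrite gt_eqF.
  by rewrite !mulr_ge0// ltW.
rewrite /rate E lt_min; apply/andP; split.
  by rewrite gt_min; apply/orP; right; apply: lt_le_trans ly _; rewrite lee_fin le_max lexx.
by rewrite gt_min (lt_trans ly yl') orbT.
Qed.

Lemma rate_inj l l' :
  (forall x : R, (0 < x)%R -> rate s2 rho x l = rate s2 rho x l') -> l = l'.
Proof.
move=> h; apply/eqP; rewrite eq_le !leNgt; apply/andP; split; apply/negP.
- by move=> /rate_lt[x x0]; rewrite h// ltxx.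
- by move=> /rate_lt[x x0]; rewrite h// ltxx.
Qed.

Lemma rate_y (x : R) : rate s2 rho x +oo = (x ^+ 2 / (2 * s2))%:E.
Proof. by rewrite /rate gt0_mulye ?lte_fin// min_l// leey. Qed.

Variables (U : R -> nat -> \bar R) (ls li : \bar R).
Hypothesis Us : forall x : R, (0 < x)%R -> limn_esup (U x) = - rate s2 rho x ls.
Hypothesis Ui : forall x : R, (0 < x)%R -> limn_einf (U x) = - rate s2 rho x li.

Lemma rate_cvg_iff l :
  (forall x : R, (0 < x)%R -> U x @ \oo --> - rate s2 rho x l) <->
  (ls = l /\ li = l).
Proof.
split=> [h|[<- li_ls] x x0]; last first.
  by apply: cvg_of_limn_esup_einf; [exact: Us|rewrite Ui// li_ls].
split; apply: rate_inj => x x0; apply: oppe_inj.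
- by rewrite -Us//; have [_ ->] := cvg_limn_einf_sup (h x x0).
- by rewrite -Ui//; have [-> _] := cvg_limn_einf_sup (h x x0).
Qed.

Lemma rate_cvg_infty :
  (forall x : R, (0 < x)%R -> U x @ \oo --> - (x ^+ 2 / (2 * s2))%:E) <-> ls = +oo.
Proof.
split=> [h|lsy x x0].
  have [] // := (rate_cvg_iff +oo).1 _.
  by move=> x x0; rewrite rate_y; exact: h.
rewrite -rate_y; move: x x0; apply/rate_cvg_iff; split => //.
(* The Gaussian value is the largest possible rate, and the liminf cannot exceed the limsup, so [li]
   is infinite as well. *)
apply: rate_inj => y y0; apply/eqP; rewrite eq_le; apply/andP; split.
  by rewrite rate_y /rate ge_min lexx.
by rewrite -lsy -leeN2 -Us// -Ui// limn_einf_sup.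
Qed.

End rate_limits.

(** * Summands with arbitrary mean *)

Section shifted_estimates.
Context {R : realType} {d : measure_display} {T : measurableType d}.
Variable P : probability T R.
Local Notation pr A := (fine (P A)).
Implicit Types X : nat -> T -> R.

Definition iid_fun X := [/\ forall i, measurable_fun setT (X i),
  (forall (n : nat) (B : nat -> set R), (forall i, measurable (B i)) ->
     P (\bigcap_(i in `I_n) (X i @^-1` B i)) = (\prod_(i < n) P (X i @^-1` B i))%E) &
  (forall i B, measurable B -> P (X i @^-1` B) = P (X 0%N @^-1` B))].

Lemma iid_fun_comp X (f : R -> R) : measurable_fun setT f -> iid_fun X ->
  iid_fun (fun i w => f (X i w)).
Proof.
move=> mf [mX indX eqX].
have mfB B : measurable B -> measurable (f @^-1` B).
  by move=> mB; rewrite -[X in measurable X]setTI; exact: mf.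
split.
- by move=> i; exact: (measurableT_comp mf).
- by move=> n B mB; apply: (indX n (fun i => f @^-1` B i)) => i; exact: mfB.
- by move=> i B mB; apply: (eqX i (f @^-1` B)); exact: mfB.
Qed.

Variables (X : nat -> T -> R) (mu s2 : R).
Hypotheses (iidX : iid_fun X) (s20 : 0 < s2).
Hypotheses (iX : P.-integrable setT (EFin \o X 0%N))
  (iX2 : P.-integrable setT (EFin \o (fun w => X 0%N w ^+ 2))).
Hypotheses (EX : \int[P]_w (X 0%N w) = mu)
  (VX : \int[P]_w ((X 0%N w - mu) ^+ 2) = s2).
Variable G : nat -> R.
Hypotheses (Gy : G n @[n --> \oo] --> +oo)
  (ay : scale_lo G n @[n --> \oo] --> +oo) (bcy : scale_hi G n @[n --> \oo] --> +oo).

Local Notation H t := (pr [set w | t < X 0%N w]).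
Local Notation D x n :=
  (pr [set w | x * scale_hi G n < \sum_(i < n) X i w - n%:R * mu]).

Let Y i w := X i w - mu.

Let iidY : iid_fun Y.
Proof. by apply: (@iid_fun_comp X (fun y => y - mu)) => //; exact: measurable_funB. Qed.

Let mX0 : measurable_fun setT (X 0%N).
Proof. by case: iidX. Qed.

Let i1 (c : R) : P.-integrable setT (EFin \o (fun _ : T => c)).
Proof. by apply: (@integrable_bounded_real _ _ _ P _ `|c|). Qed.

Let iY : P.-integrable setT (EFin \o Y 0%N).
Proof. exact: (integrable_addr iX (i1 (- mu))). Qed.

Let iY2 : P.-integrable setT (EFin \o (fun w => Y 0%N w ^+ 2)).
Proof.
apply: (@integrable_le_real _ _ _ P _ (fun w => 2 * X 0%N w ^+ 2 + 2 * mu ^+ 2)).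
- by apply: measurable_funX; case: iidY.
- move=> w; rewrite ger0_norm ?sqr_ge0// /Y.
  have := sqr_ge0 (X 0%N w + mu); rewrite sqrrD sqrrB; lra.
- by apply: integrable_addr => //; exact: integrable_scaler.
Qed.

Let EY : \int[P]_w (Y 0%N w) = 0.
Proof.
rewrite /Y RintegralB// EX Rintegral_cst// [X in fine X]probability_setT mulr1.
by rewrite subrr.
Qed.

Let DE x n : pr [set w | x * scale_hi G n < \sum_(i < n) Y i w] = D x n.
Proof.
congr (fine (P _)); apply/seteqP; split => w /=;
  by rewrite /Y sumrB sumr_const card_ord mulr_natl.
Qed.

Let HE t : pr [set w | t < Y 0%N w] = H (t + mu).
Proof.
by congr (fine (P _)); apply/seteqP; split => w /=; rewrite /Y ltrBrDr.
Qed.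

Let H_nincr t t' : t <= t' -> H t' <= H t.
Proof.
move=> tt'; apply: le_fine_probability; [exact: measurable_gt_fun..|].
by move=> w /=; exact: le_lt_trans.
Qed.

Let H_ge0 t : 0 <= H t.
Proof. by rewrite fine_ge0. Qed.

Lemma shifted_upper_estimate : upper_estimate s2 G (fun t => H t) (fun x n => D x n).
Proof.
move=> x eps x0 e0; have [mY indY eqY] := iidY.
have [c c0 Hc] := @iid_upper_estimate _ _ _ P Y mY indY eqY s2 s20 iY iY2 EY VX
  G Gy ay x eps x0 e0.
(* The shift of the tail by [mu] is absorbed by halving the constant: [- mu <= c / 2 * scale_lo G n]
   eventually. *)
exists (c / 2) => [|kappa kappa0]; first by rewrite divr_gt0.
have {}Hc := Hc _ kappa0; near=> n.
have hD : pr [set w | x * scale_hi G n < \sum_(i < n) Y i w] <=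
  n%:R * pr [set w | c * scale_lo G n < Y 0%N w] +
  expR (- (x ^+ 2 / (2 * s2) - eps) * G n +
   n%:R * (expR (kappa * G n) * pr [set w | c * scale_lo G n < Y 0%N w])) by near: n.
move: hD; rewrite DE HE => /le_trans; apply.
have h : H (c * scale_lo G n + mu) <= H (c / 2 * scale_lo G n).
  apply: H_nincr; have : 2 * `|mu| / c <= scale_lo G n by near: n; move/cvgryPge : ay; exact.
  rewrite ler_pdivrMr//; have := ler_norm (- mu); rewrite normrN; lra.
rewrite lerD ?ler_wpM2l// ler_expR lerD2l !ler_wpM2l ?expR_ge0//.
Unshelve. all: by end_near. Qed.

Lemma shifted_gauss_estimate : gauss_estimate s2 G (fun x n => D x n).
Proof.
move=> x eps x0 e0; have [mY indY eqY] := iidY.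
have := @iid_gauss_estimate _ _ _ P Y mY indY eqY s2 s20 iY iY2 EY VX
  G Gy ay x eps x0 e0.
by apply: filterS => n; rewrite DE.
Qed.

Lemma shifted_jump_estimate : jump_estimate G (fun t => H t) (fun x n => D x n).
Proof.
move=> x x0; have [mY indY eqY] := iidY.
have [u u0 Hu] := @iid_jump_estimate _ _ _ P Y mY indY eqY s2 s20 iY iY2 EY VX
  G Gy ay x x0.
(* Doubling absorbs the shift, since [mu <= u * scale_hi G n] eventually. *)
exists (2 * u) => [|eps e0]; first by rewrite mulr_gt0.
have {}Hu := Hu _ e0; near=> n.
have hD : n%:R * pr [set w | u * scale_hi G n < Y 0%N w] * expR (- eps * G n) <=
  pr [set w | x * scale_hi G n < \sum_(i < n) Y i w] by near: n.
move: hD; rewrite DE HE; apply: le_trans.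
rewrite ler_wpM2r ?expR_ge0// ler_wpM2l//; apply: H_nincr.
have : mu / u <= scale_hi G n by near: n; move/cvgryPge : bcy; exact.
rewrite ler_pdivrMr//; lra.
Unshelve. all: by end_near. Qed.

End shifted_estimates.

(** * Adding the two one-sided cases *)

Section sum_estimates.
Context {R : realType}.
Variables (s2 : R) (G : nat -> R) (H1 H2 H3 : R -> R) (D1 D2 D3 : R -> nat -> R).
Hypotheses (H1_ge0 : forall t, 0 <= H1 t) (H2_ge0 : forall t, 0 <= H2 t).
Hypotheses (H1_nincr : forall s t, s <= t -> H1 t <= H1 s)
  (H2_nincr : forall s t, s <= t -> H2 t <= H2 s).
Hypotheses (D2_ge0 : forall x n, 0 <= D2 x n).
Hypotheses (H3E : forall t, 0 <= t -> H3 t = H1 t + H2 t)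
  (D3E : forall x n, 0 < x -> D3 x n = D1 x n + D2 x n).
Hypothesis Gy : G n @[n --> \oo] --> +oo.

Lemma sum_upper_estimate : upper_estimate s2 G H1 D1 -> upper_estimate s2 G H2 D2 ->
  upper_estimate s2 G H3 D3.
Proof.
move=> U1 U2 x eps x0 e0; have e2 : 0 < eps / 2 by rewrite divr_gt0.
have [c1 c10 K1] := U1 x _ x0 e2; have [c2 c20 K2] := U2 x _ x0 e2.
exists (Num.min c1 c2) => [|kappa kappa0]; first by rewrite lt_min c10.
have {}K1 := K1 _ kappa0; have {}K2 := K2 _ kappa0.
pose A := x ^+ 2 / (2 * s2); near=> n.
have d1 : D1 x n <= n%:R * H1 (c1 * scale_lo G n) + expR (- (A - eps / 2) * G n +
    n%:R * (expR (kappa * G n) * H1 (c1 * scale_lo G n))) by near: n.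
have d2 : D2 x n <= n%:R * H2 (c2 * scale_lo G n) + expR (- (A - eps / 2) * G n +
    n%:R * (expR (kappa * G n) * H2 (c2 * scale_lo G n))) by near: n.
set c := Num.min c1 c2; set al := scale_lo G n in d1 d2 *; rewrite -/A.
have c0 : 0 < c by rewrite lt_min c10.
have al0 : 0 <= al by exact: sqrtr_ge0.
have cal : 0 <= c * al by rewrite mulr_ge0 ?(ltW c0).
have h1 : H1 (c1 * al) <= H1 (c * al).
  by apply: H1_nincr; rewrite ler_wpM2r// ge_min lexx.
have h2 : H2 (c2 * al) <= H2 (c * al).
  by apply: H2_nincr; rewrite ler_wpM2r// ge_min lexx orbT.
(* A common majorant of the two exponential terms. The resulting factor 2 is paid for by the half of
   [eps] held in reserve. *)
pose Q := expR (- (A - eps / 2) * G n + n%:R * (expR (kappa * G n) * H3 (c * al))).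
have q1 : expR (- (A - eps / 2) * G n +
    n%:R * (expR (kappa * G n) * H1 (c1 * al))) <= Q.
  rewrite ler_expR lerD2l !ler_wpM2l ?expR_ge0// H3E//.
  by apply: le_trans h1 _; rewrite lerDl.
have q2 : expR (- (A - eps / 2) * G n +
    n%:R * (expR (kappa * G n) * H2 (c2 * al))) <= Q.
  rewrite ler_expR lerD2l !ler_wpM2l ?expR_ge0// H3E//.
  by apply: le_trans h2 _; rewrite lerDr.
have big : 2 <= expR (eps / 2 * G n).
  apply: le_trans (expR_ge1Dx _).
  have : 1 / (eps / 2) <= G n by near: n; move/cvgryPge : Gy; exact.
  by rewrite ler_pdivrMr// mulrC; lra.
have QE : 2 * Q <= expR (- (A - eps) * G n + n%:R * (expR (kappa * G n) * H3 (c * al))).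
  apply: (@le_trans _ _ (expR (eps / 2 * G n) * Q)).
    by rewrite ler_wpM2r// expR_ge0.
  rewrite /Q -expRD ler_expR addrA lerD2r; lra.
have n1 : n%:R * H1 (c1 * al) <= n%:R * H1 (c * al) by rewrite ler_wpM2l.
have n2 : n%:R * H2 (c2 * al) <= n%:R * H2 (c * al) by rewrite ler_wpM2l.
rewrite D3E//; apply: le_trans (lerD (lexx _) QE); rewrite [H3 _ in X in _ <= X + _]H3E// mulrDr.
lra.
Unshelve. all: by end_near. Qed.

Lemma sum_gauss_estimate : gauss_estimate s2 G D1 -> gauss_estimate s2 G D3.
Proof.
move=> g1 x eps x0 e0; apply: filterS (g1 x eps x0 e0) => n /le_trans; apply.
by rewrite D3E// lerDl.
Qed.

Lemma sum_jump_estimate : jump_estimate G H1 D1 -> jump_estimate G H2 D2 ->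
  jump_estimate G H3 D3.
Proof.
move=> J1 J2 x x0; have [u1 u10 K1] := J1 x x0; have [u2 u20 K2] := J2 x x0.
exists (Num.max u1 u2) => [|eps e0]; first by rewrite lt_max u10.
have b0 n : 0 <= scale_hi G n by exact: sqrtr_ge0.
apply: filterS2 (K1 _ e0) (K2 _ e0) => n k1 k2.
rewrite D3E// H3E; last by rewrite mulr_ge0// le_max (ltW u10).
rewrite mulrDr mulrDl lerD//.
  apply: le_trans k1; rewrite ler_wpM2r ?expR_ge0// ler_wpM2l// H1_nincr//.
  by rewrite ler_wpM2r// le_max lexx.
apply: le_trans k2; rewrite ler_wpM2r ?expR_ge0// ler_wpM2l// H2_nincr//.
by rewrite ler_wpM2r// le_max lexx orbT.
Qed.

End sum_estimates.

Section deviation_limits.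
Context {R : realType} {d : measure_display} {T : measurableType d}.
Variables (P : probability T R) (rho : R) (g : R -> R) (s2 : R).
Hypothesis rv : regvar_class rho g.
Variables (A : R -> set T) (B : R -> nat -> set T).
Hypotheses (mA : forall t, measurable (A t)) (mB : forall x n, measurable (B x n)).
Hypothesis A_nincr : forall s t, s <= t -> A t `<=` A s.
Local Notation G := (fun n : nat => g (ln n%:R)).
Local Notation H := (fun t => fine (P (A t))).
Local Notation D := (fun x n => fine (P (B x n))).
Hypotheses (Hu : upper_estimate s2 G H D) (Hg : gauss_estimate s2 G D)
  (Hj : jump_estimate G H D).

Lemma deviation_limits (x : R) : 0 < x ->
  (limn_esup (fun n => seq_ratio g n (P (B x n))) =
   - rate s2 rho x (- limf_esup (fun t => tail_ratio g t (P (A t))) (pinfty_nbhs R)) /\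
   limn_einf (fun n => seq_ratio g n (P (B x n))) =
   - rate s2 rho x (- limf_einf (fun t => tail_ratio g t (P (A t))) (pinfty_nbhs R)))%E.
Proof.
move=> x0.
have -> : (fun n => seq_ratio g n (P (B x n))) = (fun n => seq_ratio g n (D x n)%:E).
  by apply/funext => n; rewrite fineK// fin_num_measure.
have -> : (fun t => tail_ratio g t (P (A t))) = (fun t => tail_ratio g t (H t)%:E).
  by apply/funext => n; rewrite fineK// fin_num_measure.
have H0 t : 0 <= H t by exact: fine_ge0.
have Hn s t : s <= t -> H t <= H s by move=> st; apply: le_fine_probability => //; exact: A_nincr.
have D1 y n : D y n <= 1.
  by rewrite -lee_fin fineK ?fin_num_measure// probability_le1.
have D0 y n : 0 <= D y n by exact: fine_ge0.
split; first exact: (limn_esup_rate rv H0 Hn D0 D1 Hu Hg Hj x0).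
exact: (limn_einf_rate rv H0 Hn D0 D1 Hu Hg Hj x0).
Qed.

End deviation_limits.

(** * Consequences of a finite second moment *)

Section second_moment.
Context {R : realType} {d : measure_display} {T : measurableType d}.
Variables (P : probability T R) (X : {RV P >-> R}).
Hypothesis EX2 : ('E_P[fun w => (X w ^+ 2)%R] < +oo)%E.
Local Notation mu := (fine 'E_P[X]).

Lemma integrable_RV_sqr : P.-integrable setT (EFin \o (fun w => X w ^+ 2)).
Proof.
apply/integrableP; split.
  by apply/measurable_EFinP; exact: measurable_funX.
move: EX2; rewrite unlock; apply: le_lt_trans.
apply: ge0_le_integral => //.
- by apply/measurableT_comp => //; apply/measurable_EFinP; exact: measurable_funX.
- by apply/measurable_EFinP; exact: measurable_funX.
- by move=> w _ /=; rewrite lee_fin ger0_norm ?sqr_ge0.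
Qed.

Lemma integrable_RV : P.-integrable setT (EFin \o X).
Proof.
apply: (@integrable_le_real _ _ _ P _ (fun w => 1 + X w ^+ 2)) => //.
  move=> w; rewrite ler_norml; have := sqr_ge0 (X w - 1); have := sqr_ge0 (X w + 1).
  rewrite sqrrD sqrrB; have := sqr_ge0 (X w); move=> h1 h2 h3; apply/andP; split; lra.
apply: integrable_addr; last exact: integrable_RV_sqr.
by apply: (@integrable_bounded_real _ _ _ P _ 1) => // w; rewrite normr1.
Qed.

Lemma Rintegral_mean : \int[P]_w (X w) = mu.
Proof. by rewrite /Rintegral unlock. Qed.

Lemma Rintegral_variance : \int[P]_w ((X w - mu) ^+ 2) = fine 'V_P[X].
Proof.
rewrite /Rintegral /variance !unlock.
by congr fine; apply: eq_integral => w _; rewrite expr2.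
Qed.

Lemma variance_gt0 : ~ (exists c : R, P [set w | X w = c] = 1%E) ->
  0 < fine 'V_P[X].
Proof.
move=> nondeg; rewrite -Rintegral_variance lt_neqAle; apply/andP; split; last first.
  by apply: Rintegral_ge0 => w _; exact: sqr_ge0.
apply/eqP => V0; apply: nondeg; exists mu.
have mf : measurable_fun setT (fun w => (X w - mu) ^+ 2).
  by apply: measurable_funX; exact: measurable_funB.
have iV : P.-integrable setT (EFin \o (fun w => (X w - mu) ^+ 2)).
  apply: (@integrable_le_real _ _ _ P _ (fun w => 2 * X w ^+ 2 + 2 * mu ^+ 2)) => //.
  - move=> w; rewrite ger0_norm ?sqr_ge0//.
    have := sqr_ge0 (X w + mu); rewrite sqrrD sqrrB; lra.
  - apply: integrable_addr; first by apply: integrable_scaler; exact: integrable_RV_sqr.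
    exact: (@integrable_bounded_real _ _ _ P _ `|2 * mu ^+ 2|).
have I0 : (\int[P]_w `|((X w - mu) ^+ 2)%:E| = 0)%E.
  transitivity (\int[P]_w ((X w - mu) ^+ 2)%:E)%E.
    by apply: eq_integral => w _; rewrite /= ger0_norm ?sqr_ge0.
  rewrite -[LHS]fineK; last exact: (integrable_fin_num measurableT iV).
  by rewrite -[X in X%:E]/(Rintegral P setT _) -V0.
have [N [mN PN XN]] := (@ae_eq_integral_abs _ _ _ P setT measurableT
  (fun w => ((X w - mu) ^+ 2)%:E) ((measurable_EFinP _ _).2 mf)).1 I0.
have mE : measurable [set w | X w = mu].
  by rewrite -[X in measurable X]setTI; exact: (measurable_funP X measurableT [set mu]).
apply/eqP; rewrite eq_le probability_le1//=.
(* [N] is a null set containing every point where [X] differs from [mu], so its complement lies in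
   the event [X = mu], against nondegeneracy. *)
have -> : 1%E = P (~` N) by rewrite probability_setC// PN sube0.
apply: le_measure; rewrite ?inE//; first exact: measurableC.
move=> w /=; apply: contra_notP => Xw; apply: XN => /= /(_ Logic.I)[] /eqP.
by rewrite sqrf_eq0 subr_eq0 => /eqP.
Qed.

End second_moment.

Lemma probability_norm_gt {R : realType} {d : measure_display}
    {T : measurableType d} (P : probability T R) (V : T -> R) (t : R) :
  0 <= t -> measurable_fun setT V ->
  fine (P [set w | t < `|V w|]) =
  fine (P [set w | t < V w]) + fine (P [set w | t < - V w]).
Proof.
move=> t0 mV; have mVN := measurable_funN mV.
have m1 : measurable [set w | t < V w] by exact: measurable_gt_fun.
have m2 : measurable [set w | t < - V w] by exact: (measurable_gt_fun _ mVN).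
rewrite -fineD ?fin_num_measure// -measureU//.
  by congr (fine (P _)); apply/seteqP; split => w /=; rewrite ltr_normr => /orP.
apply/seteqP; split => [w [/= h1 h2]|w []//].
have : 0 < V w - V w by rewrite addr_gt0// (le_lt_trans t0).
by rewrite subrr ltxx.
Qed.

Unset Implicit Arguments.
Set Strict Implicit.

Theorem theorem2p1 (R : realType) (d : measure_display) (T : measurableType d)
    (P : probability T R) (X : nat -> {RV P >-> R}) (rho : R) (g : R -> R) :
  iid_seq X ->
  ~ (exists c : R, P [set w | X 0%N w = c] = 1%E) ->
  ('E_P[fun w => (X 0%N w ^+ 2)%R] < +oo)%E ->
  0 <= rho ->
  regvar_class rho g ->
  let mu := fine 'E_P[X 0%N] in
  let sigma2 := fine 'V_P[X 0%N] in
  (forall x : R, 0 < x ->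
     (limn_esup (dev_up g X mu x) = (- rate sigma2 rho x (lam_sup1 P g (X 0%N)))%E
      /\ limn_einf (dev_up g X mu x) = (- rate sigma2 rho x (lam_inf1 P g (X 0%N)))%E)
     /\ (limn_esup (dev_down g X mu x) = (- rate sigma2 rho x (lam_sup2 P g (X 0%N)))%E
      /\ limn_einf (dev_down g X mu x) = (- rate sigma2 rho x (lam_inf2 P g (X 0%N)))%E)
     /\ (limn_esup (dev_abs g X mu x) = (- rate sigma2 rho x (lam_sup P g (X 0%N)))%E
      /\ limn_einf (dev_abs g X mu x) = (- rate sigma2 rho x (lam_inf P g (X 0%N)))%E))
  /\
  (forall lh : \bar R, (0 <= lh)%E ->
     [/\ ((forall x : R, 0 < x ->
            dev_up g X mu x @ \oo --> (- rate sigma2 rho x lh)%E)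
         <-> (lam_sup1 P g (X 0%N) = lh /\ lam_inf1 P g (X 0%N) = lh)),
         ((forall x : R, 0 < x ->
            dev_down g X mu x @ \oo --> (- rate sigma2 rho x lh)%E)
         <-> (lam_sup2 P g (X 0%N) = lh /\ lam_inf2 P g (X 0%N) = lh))
       & ((forall x : R, 0 < x ->
            dev_abs g X mu x @ \oo --> (- rate sigma2 rho x lh)%E)
         <-> (lam_sup P g (X 0%N) = lh /\ lam_inf P g (X 0%N) = lh))])
  /\
  [/\ ((forall x : R, 0 < x ->
         dev_up g X mu x @ \oo --> (- (x ^+ 2 / (2 * sigma2))%:E)%E)
      <-> lam_sup1 P g (X 0%N) = +oo%E),
      ((forall x : R, 0 < x ->
         dev_down g X mu x @ \oo --> (- (x ^+ 2 / (2 * sigma2))%:E)%E)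
      <-> lam_sup2 P g (X 0%N) = +oo%E)
    & ((forall x : R, 0 < x ->
         dev_abs g X mu x @ \oo --> (- (x ^+ 2 / (2 * sigma2))%:E)%E)
      <-> lam_sup P g (X 0%N) = +oo%E)].
Proof.
move=> [indX eqX] nondeg EX2 rho0 rv mu sigma2.
have s20 : 0 < sigma2 by exact: variance_gt0.
have mX i : measurable_fun setT (X i) by [].
have iidX : iid_fun P X by split.
have iX := integrable_RV EX2; have iX2 := integrable_RV_sqr EX2.
have EX : \int[P]_w (X 0%N w) = mu := Rintegral_mean _.
have VX : \int[P]_w ((X 0%N w - mu) ^+ 2) = sigma2 := Rintegral_variance _.
(* Lower deviations are upper deviations of the opposite variables, which have mean [- mu] and the
   same variance. *)
have iidN : iid_fun P (fun i w => - X i w).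
  apply: (@iid_fun_comp _ _ _ P (fun i w => X i w) (fun y => - y) _ iidX).
  exact: measurable_funN.
have iN : P.-integrable setT (EFin \o (fun w => - X 0%N w)).
  rewrite (_ : (fun w => - X 0%N w) = (fun w => -1 * X 0%N w)).
    exact: integrable_scaler.
  by apply/funext => w; rewrite mulN1r.
have iN2 : P.-integrable setT (EFin \o (fun w => (- X 0%N w) ^+ 2)).
  by under eq_fun do rewrite sqrrN.
have EN : \int[P]_w (- X 0%N w) = - mu.
  by under eq_Rintegral do rewrite -mulN1r; rewrite RintegralZl// EX mulN1r.
have VN : \int[P]_w ((- X 0%N w - - mu) ^+ 2) = sigma2.
  by under eq_Rintegral do rewrite -opprD sqrrN.
pose G n := g (ln n%:R).
have Gy : G n @[n --> \oo] --> +oo := regvar_ln_cvgy rv.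
have ay : scale_lo G n @[n --> \oo] --> +oo := scale_lo_cvgy rv.
have bcy : scale_hi G n @[n --> \oo] --> +oo := scale_hi_cvgy rv.
pose A1 t := [set w | t < X 0%N w]; pose A2 t := [set w | t < - X 0%N w].
pose A3 t := [set w | t < `|X 0%N w|].
pose B1 x n := [set w | x * scale_hi G n < \sum_(i < n) X i w - n%:R * mu].
pose B2 x n := [set w | x * scale_hi G n < \sum_(i < n) - X i w - n%:R * - mu].
pose B3 x n := [set w | x * scale_hi G n < `|\sum_(i < n) X i w - n%:R * mu|].
have mN : measurable_fun setT (fun w => - X 0%N w) by exact: measurable_funN.
have mS n : measurable_fun setT (fun w => \sum_(i < n) X i w - n%:R * mu).
  by apply: measurable_funB => //; exact: measurable_sum.
have mSN n : measurable_fun setT (fun w => \sum_(i < n) - X i w - n%:R * - mu).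
  by apply: measurable_funB => //; apply: measurable_sum => i; exact: measurable_funN.
have mA1 t : measurable (A1 t) by exact: measurable_gt_fun.
have mA2 t : measurable (A2 t) by exact: measurable_gt_fun.
have mA3 t : measurable (A3 t) by apply: measurable_gt_fun; exact: measurableT_comp.
have mB1 x n : measurable (B1 x n) by exact: (measurable_gt_fun _ (mS n)).
have mB2 x n : measurable (B2 x n) by exact: (measurable_gt_fun _ (mSN n)).
have mB3 x n : measurable (B3 x n).
  by apply: (measurable_gt_fun (V := fun w => `|\sum_(i < n) X i w - n%:R * mu|));
    exact: measurableT_comp.
have nA1 s t : s <= t -> A1 t `<=` A1 s by move=> st w /=; exact: le_lt_trans.
have nA2 s t : s <= t -> A2 t `<=` A2 s by move=> st w /=; exact: le_lt_trans.
have nA3 s t : s <= t -> A3 t `<=` A3 s by move=> st w /=; exact: le_lt_trans.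
have u1 := shifted_upper_estimate iidX s20 iX iX2 EX VX Gy ay.
have g1 := shifted_gauss_estimate iidX s20 iX iX2 EX VX Gy ay.
have j1 := shifted_jump_estimate iidX s20 iX iX2 EX VX Gy ay bcy.
have u2 := shifted_upper_estimate iidN s20 iN iN2 EN VN Gy ay.
have g2 := shifted_gauss_estimate iidN s20 iN iN2 EN VN Gy ay.
have j2 := shifted_jump_estimate iidN s20 iN iN2 EN VN Gy ay bcy.
have BN x n : B2 x n = [set w | x * scale_hi G n < - (\sum_(i < n) X i w - n%:R * mu)].
  have E w : \sum_(i < n) - X i w - n%:R * - mu = - (\sum_(i < n) X i w - n%:R * mu).
    by rewrite mulrN opprK opprB -sumrN addrC.
  by apply/seteqP; split => w; rewrite /B2/= E.
have H3E t : 0 <= t -> fine (P (A3 t)) = fine (P (A1 t)) + fine (P (A2 t)).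
  by move=> t0; exact: probability_norm_gt.
have D3E x n : 0 < x -> fine (P (B3 x n)) = fine (P (B1 x n)) + fine (P (B2 x n)).
  move=> x0; rewrite BN; apply: probability_norm_gt => //.
  by rewrite mulr_ge0 ?(ltW x0)// sqrtr_ge0.
have H10 t : 0 <= fine (P (A1 t)) by exact: fine_ge0.
have H20 t : 0 <= fine (P (A2 t)) by exact: fine_ge0.
have D20 x n : 0 <= fine (P (B2 x n)) by exact: fine_ge0.
have H1n s t : s <= t -> fine (P (A1 t)) <= fine (P (A1 s)).
  by move=> st; apply: le_fine_probability => //; exact: nA1.
have H2n s t : s <= t -> fine (P (A2 t)) <= fine (P (A2 s)).
  by move=> st; apply: le_fine_probability => //; exact: nA2.
(* For the modulus, tails and deviations at nonnegative levels are sums over disjoint events, so the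
   one-sided estimates add up. *)
have u3 := sum_upper_estimate H10 H20 H1n H2n H3E D3E Gy u1 u2.
have g3 := sum_gauss_estimate D20 D3E g1.
have j3 := sum_jump_estimate H1n H2n H3E D3E j1 j2.
have L1 := deviation_limits rv mA1 mB1 nA1 u1 g1 j1.
have L2 := deviation_limits rv mA2 mB2 nA2 u2 g2 j2.
have L3 := deviation_limits rv mA3 mB3 nA3 u3 g3 j3.
have dn x n : P (B2 x n) = P [set w | psum X n w - n%:R * mu <
    - (x * Num.sqrt (n%:R * g (ln n%:R)))].
  by rewrite BN; congr (P _); apply/seteqP; split => w /=; rewrite ltrNr.
have tn t : P (A2 t) = P [set w | X 0%N w < - t].
  by congr (P _); apply/seteqP; split => w /=; rewrite ltrNr.
have {}L2 x : 0 < x ->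
    (limn_esup (dev_down g X mu x) = - rate sigma2 rho x (lam_sup2 P g (X 0%N)) /\
     limn_einf (dev_down g X mu x) = - rate sigma2 rho x (lam_inf2 P g (X 0%N)))%E.
  move=> x0; have := L2 x x0.
  under [X in limn_esup X]eq_fun do rewrite dn.
  under [X in limn_einf X]eq_fun do rewrite dn.
  under [X in limf_esup X]eq_fun do rewrite tn.
  under [X in limf_einf X]eq_fun do rewrite tn.
  exact.
split; first by move=> x x0; split; [exact: L1|split; [exact: L2|exact: L3]].
split.
  move=> lh lh0; split.
  - exact: (rate_cvg_iff s20 (fun x x0 => (L1 x x0).1) (fun x x0 => (L1 x x0).2)).
  - exact: (rate_cvg_iff s20 (fun x x0 => (L2 x x0).1) (fun x x0 => (L2 x x0).2)).
  - exact: (rate_cvg_iff s20 (fun x x0 => (L3 x x0).1) (fun x x0 => (L3 x x0).2)).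
split.
- exact: (rate_cvg_infty s20 (fun x x0 => (L1 x x0).1) (fun x x0 => (L1 x x0).2)).
- exact: (rate_cvg_infty s20 (fun x x0 => (L2 x x0).1) (fun x x0 => (L2 x x0).2)).
- exact: (rate_cvg_infty s20 (fun x x0 => (L3 x x0).1) (fun x x0 => (L3 x x0).2)).
Qed.
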